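(* Let $d\ge2$, $\alpha\ge 0$ and $1\le p,q,r\le\infty$. If $\mathcal B^\alpha$ is bounded from $L^p(\mathbb R^d)\times L^q(\mathbb R^d)$ to $L^r(\mathbb R^d)$, i.e. there is a constant $C$ with $\|\mathcal B^\alpha(f,g)\|_{L^r(\mathbb R^d)}\le C\|f\|_{L^p(\mathbb R^d)}\|g\|_{L^q(\mathbb R^d)}$ for all $f,g\in\mathcal S(\mathbb R^d)$, then $$\alpha\ge\max\Big\{\frac{d-1}2-\frac dp-\frac d{2q},\ \frac{d-1}2-\frac dq-\frac d{2p},\ 0\Big\}.$$
   Context: $\mathcal S(\mathbb R^d)$ is the Schwartz space and $\widehat f(\xi)=\int_{\mathbb R^d} e^{-2\pi i x\cdot\xi}f(x)\,dx$. The bilinear Bochner-Riesz operator of order $\alpha\ge0$ is $$\mathcal B^\alpha(f,g)(x)=\iint_{\mathbb R^d\times\mathbb R^d}e^{2\pi i x\cdot(\xi+\eta)}(1-|\xi|^2-|\eta|^2)_+^\alpha\,\widehat f(\xi)\widehat g(\eta)\,d\xi d\eta,\qquad f,g\in\mathcal S(\mathbb R^d),$$ where $(1-|\xi|^2-|\eta|^2)^\alpha_+$ equals $(1-|\xi|^2-|\eta|^2)^\alpha$ when $|\xi|^2+|\eta|^2<1$ and is $0$ otherwise. *)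

(* Defs.v *)
From HB Require Import structures.
From mathcomp Require Import all_boot all_order all_algebra.
From mathcomp Require Import complex.
From mathcomp Require Import all_classical all_reals all_analysis.

Set Implicit Arguments.
Unset Strict Implicit.
Unset Printing Implicit Defensive.

Import Order.TTheory GRing.Theory Num.Theory.
Import numFieldNormedType.Exports.

Local Open Scope classical_set_scope.
Local Open Scope ring_scope.

Definition measure_rV_display : measure_display. Proof. exact. Qed.

(* The sigma-algebra on 'rV[R]_n generated by the coordinate maps into the
   Borel line (the same construction as the library's one on n.-tuple T); it is
   the Borel sigma-algebra of R^n. *)
Section measurable_rV.
Context {R : realType} {n : nat}.

Let coors : 'I_n -> 'rV[R]_n -> measurableTypeR R := fun i x => x ord0 i.

Let rV_set0 : g_sigma_preimage coors set0.
Proof. exact: sigma_algebra0. Qed.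

Let rV_setC A : g_sigma_preimage coors A -> g_sigma_preimage coors (~` A).
Proof. exact: sigma_algebraC. Qed.

Let rV_bigcup (F : _^nat) : (forall i, g_sigma_preimage coors (F i)) ->
  g_sigma_preimage coors (\bigcup_i (F i)).
Proof. exact: sigma_algebra_bigcup. Qed.

HB.instance Definition _ := @isMeasurable.Build measure_rV_display
  'rV[R]_n (g_sigma_preimage coors) rV_set0 rV_setC rV_bigcup.

Lemma measurable_rV_coord (i : 'I_n) :
  measurable_fun [set: 'rV[R]_n] (fun x : 'rV[R]_n => x ord0 i : measurableTypeR R).
Proof.
move=> _ Y mY; rewrite setTI; apply: sub_sigma_algebra => /=.
rewrite -bigcup_seq/=; exists i => /=; first by rewrite mem_index_enum.
by exists Y => //; rewrite setTI.
Qed.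

Lemma measurable_fun_rVP d (T : measurableType d) (f : T -> 'rV[R]_n) :
  (forall i, measurable_fun [set: T] (fun t => f t ord0 i : measurableTypeR R)) ->
  measurable_fun [set: T] f.
Proof.
move=> mf.
suff h : g_sigma_preimage (fun i => coors i \o f) `<=` measurable.
  move=> _ A mA; apply: h; rewrite g_sigma_preimage_comp.
  by exists A.
apply: smallest_sub; first exact: sigma_algebra_measurable.
by rewrite -bigcup_seq; apply: bigcup_sub => i _ A [B mB <-]; exact: mf.
Qed.

End measurable_rV.

Section lebesgue_rV.
Context {R : realType}.

Definition rV_cons n (p : measurableTypeR R * 'rV[R]_n) : 'rV[R]_n.+1 :=
  \row_i oapp (p.2 ord0) (p.1 : R) (unlift ord0 i).

Definition rV_uncons n (x : 'rV[R]_n.+1) : measurableTypeR R * 'rV[R]_n :=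
  (x ord0 ord0, \row_i x ord0 (lift ord0 i)).

Lemma rV_consK n : cancel (@rV_cons n) (@rV_uncons n).
Proof.
move=> [t x]; congr pair; first by rewrite mxE unlift_none.
by apply/rowP => i; rewrite !mxE liftK.
Qed.

Lemma rV_unconsK n : cancel (@rV_uncons n) (@rV_cons n).
Proof.
move=> x; apply/rowP => i; rewrite !mxE.
by case: unliftP => [j ->|->] //=; rewrite mxE.
Qed.

Lemma measurable_rV_cons n : measurable_fun setT (@rV_cons n).
Proof.
apply: measurable_fun_rVP => i.
case: (unliftP ord0 i) => [j ->|->].
  under eq_fun do rewrite mxE liftK /=.
  exact: measurableT_comp (measurable_rV_coord j) measurable_snd.
under eq_fun do rewrite mxE unlift_none /=.
exact: measurable_fst.
Qed.

Lemma measurable_rV_uncons n : measurable_fun setT (@rV_uncons n).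
Proof.
apply: measurable_fun_pair; first exact: measurable_rV_coord.
apply: measurable_fun_rVP => i; under eq_fun do rewrite mxE.
exact: measurable_rV_coord.
Qed.

Section lebesgue_rV_succ.
Variables (n : nat) (m : {sigma_finite_measure set 'rV[R]_n -> \bar R}).

Let leb : {sigma_finite_measure set (measurableTypeR R) -> \bar R} :=
  @lebesgue_measure R.

Definition lebesgue_rV_succ : set 'rV[R]_n.+1 -> \bar R :=
  pushforward (leb \x m)%E (@rV_cons n).

Let measurable_preimage_cons (A : set 'rV[R]_n.+1) :
  measurable A -> measurable (@rV_cons n @^-1` A).
Proof. by move=> mA; rewrite -[X in measurable X]setTI; exact: measurable_rV_cons. Qed.

Let succ0 : lebesgue_rV_succ set0 = 0%E.
Proof. by rewrite /lebesgue_rV_succ /pushforward preimage_set0 measure0. Qed.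

Let succ_ge0 A : (0 <= lebesgue_rV_succ A)%E.
Proof. by rewrite /lebesgue_rV_succ /pushforward measure_ge0. Qed.

Let succ_sigma_additive : semi_sigma_additive lebesgue_rV_succ.
Proof.
move=> F mF tF mUF; rewrite /lebesgue_rV_succ /pushforward preimage_bigcup.
apply: measure_semi_sigma_additive.
- by move=> k; exact: measurable_preimage_cons.
- apply/trivIsetP => /= i j _ _ ij; rewrite -preimage_setI.
  by move/trivIsetP : tF => /(_ _ _ _ _ ij) ->//; rewrite preimage_set0.
- by rewrite -preimage_bigcup; exact: measurable_preimage_cons.
Qed.

HB.instance Definition _ := isMeasure.Build _ _ _
  lebesgue_rV_succ succ0 succ_ge0 succ_sigma_additive.

Let succ_sigma_finite : sigma_finite setT lebesgue_rV_succ.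
Proof.
have /sigma_finiteP[F [FT ndF Foo]] := sigma_finiteT leb.
have /sigma_finiteP[G [GT ndG Goo]] := sigma_finiteT m.
exists (fun k => @rV_uncons n @^-1` (F k `*` G k)).
  apply/esym; rewrite -subTset => x _ /=.
  have : setT (rV_uncons x).1 by [].
  have : setT (rV_uncons x).2 by [].
  rewrite {1}GT {1}FT => -[k _ Gkx] [j _ Fjx]; exists (maxn j k) => //; split.
  - by move: Fjx; exact/subsetPset/ndF/leq_maxl.
  - by move: Gkx; exact/subsetPset/ndG/leq_maxr.
move=> k; have [mF Fk] := Foo k; have [mG Gk] := Goo k; split.
  rewrite -[X in measurable X]setTI; apply: measurable_rV_uncons => //.
  exact: measurableX.
have E (X : set (measurableTypeR R * 'rV[R]_n)) :
    @rV_cons n @^-1` (@rV_uncons n @^-1` X) = X.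
  by apply/seteqP; split => x; rewrite /preimage /mkset rV_consK.
by rewrite /lebesgue_rV_succ /pushforward E product_measure1E// lte_mul_pinfty// ge0_fin_numE.
Qed.

HB.instance Definition _ := Measure_isSigmaFinite.Build _ _ _
  lebesgue_rV_succ succ_sigma_finite.

End lebesgue_rV_succ.

(* Lebesgue measure on R^n, as the n-fold product of Lebesgue measure on R; the
   point mass on the one-point space R^0. *)
Fixpoint lebesgue_rV n : {sigma_finite_measure set 'rV[R]_n -> \bar R} :=
  if n is k.+1 then lebesgue_rV_succ (lebesgue_rV k) else @dirac _ 'rV[R]_0 0 R.

Lemma lebesgue_rV_box n (A : 'I_n -> set (measurableTypeR R)) :
  (forall i, measurable (A i)) ->
  lebesgue_rV n [set x : 'rV[R]_n | forall i, A i (x ord0 i)] =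
  (\prod_(i < n) @lebesgue_measure R (A i))%E.
Proof.
elim: n A => [|n IH] A mA.
  rewrite big_ord0 /= diracE mem_set//=; by case.
rewrite big_ord_recl -IH // /= /lebesgue_rV_succ /pushforward.
rewrite -product_measure1E //; last first.
  have -> : [set x : 'rV[R]_n | forall i, A (lift ord0 i) (x ord0 i)] =
     \big[setI/setT]_(i < n) ((fun x : 'rV[R]_n => x ord0 i : measurableTypeR R) @^-1` A (lift ord0 i)).
    rewrite -bigcap_seq; apply/seteqP; split => x /= h i; first by move=> _; exact: h.
    by apply: h => /=; rewrite mem_index_enum.
  apply: bigsetI_measurable => i _.
  by rewrite -[X in measurable X]setTI; exact: measurable_rV_coord.
congr (product_measure1 _ _ _); apply/seteqP; split => -[t x] /=.
  move=> h; split; first by have := h ord0; rewrite mxE unlift_none.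
  by move=> i; have := h (lift ord0 i); rewrite mxE liftK.
move=> [h0 h] i; rewrite mxE.
by case: unliftP => [j ->|->] //=; exact: h.
Qed.

End lebesgue_rV.

Section bilinear_bochner_riesz.
Context {R : realType}.
Local Notation C := R[i].

Definition cintegral d (T : measurableType d) (mu : {measure set T -> \bar R})
    (f : T -> C) : C :=
  Complex (\int[mu]_x complex.Re (f x)) (\int[mu]_x complex.Im (f x)).

Definition cexpi (t : R) : C := Complex (cos t) (sin t).

Variable d : nat.
Local Notation Rd := 'rV[R]_d.

Definition dot (x y : Rd) : R := \sum_(i < d) x ord0 i * y ord0 i.

(* The Euclidean square norm: the library norm on 'rV[R]_d is the sup norm. *)
Definition sqnorm (x : Rd) : R := dot x x.

Definition pderiv (s : seq 'I_d) (u : Rd -> R) : Rd -> R :=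
  foldr (fun i v => fun x => 'D_(delta_mx ord0 i : Rd) v x) u s.

Definition monomial (b : 'I_d -> nat) (x : Rd) : R := \prod_(i < d) x ord0 i ^+ b i.

(* Differentiability of every iterated partial derivative is C^infinity
   smoothness: it makes all of them exist and be continuous. *)
Definition schwartz_real (u : Rd -> R) : Prop :=
  (forall s x, differentiable (pderiv s u) x) /\
  (forall (b : 'I_d -> nat) s, exists M : R,
     forall x, `|monomial b x * pderiv s u x| <= M).

Definition schwartz (f : Rd -> C) : Prop :=
  schwartz_real (fun x => complex.Re (f x)) /\
  schwartz_real (fun x => complex.Im (f x)).

Definition Lpnorm (p : \bar R) (f : Rd -> C) : \bar R :=
  Lnorm (lebesgue_rV d) p (fun x => (ComplexField.Normc.normc (f x))%:E).

Definition fourier (f : Rd -> C) (xi : Rd) : C :=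
  cintegral (lebesgue_rV d) (fun x => cexpi (- (2 * pi * dot x xi)) * f x).

(* The case distinction matters at alpha = 0, where 0 `^ 0 = 1. *)
Definition bochner_riesz_symbol (alpha : R) (xi eta : Rd) : R :=
  if sqnorm xi + sqnorm eta < 1
  then (1 - sqnorm xi - sqnorm eta) `^ alpha else 0.

Definition bilinear_bochner_riesz (alpha : R) (f g : Rd -> C) (x : Rd) : C :=
  cintegral (lebesgue_rV d \x lebesgue_rV d)%E (fun z =>
    cexpi (2 * pi * dot x (z.1 + z.2)) *
    real_complex R (bochner_riesz_symbol alpha z.1 z.2) *
    fourier f z.1 * fourier g z.2).

Definition bounded_on_schwartz (T : (Rd -> C) -> (Rd -> C) -> Rd -> C)
    (p q r : \bar R) : Prop :=
  exists K : R, forall f g : Rd -> C, schwartz f -> schwartz g ->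
    (Lpnorm r (T f g) <= K%:E * Lpnorm p f * Lpnorm q g)%E.

End bilinear_bochner_riesz.

(* Main.v *)
(** Write d = n + 1, delta = M^-2 and let g be the Gaussian of width M, whose
    Fourier transform lives at scale delta^(1/2).  For f take a sum of M^n
    Gaussian wave packets on tubes of size delta^-1 x (delta^(-1/2))^n through
    the origin, with delta^(1/2)-separated directions and frequencies next to
    the corresponding points of the unit sphere.  Multiplying by
    (1 - e^(2 pi i delta y_0))^n makes f vanish where the tubes overlap too
    much, so |f| is at most C exp(- c delta^2 |y|^2) and
    ||f||_p <= C delta^(-d/p), while ||g||_q <= C delta^(-d/(2q)).  The
    frequencies are pushed slightly outside the ball so that both Fourier
    transforms are nonnegative on the unit ball; for |x| small the real part of
    the oscillating factor is at least 1/2, so nothing cancels, and every packet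
    contributes at least c delta^alpha to B(f, g)(x), whence
    Re B(f, g)(x) >= c M^n delta^alpha on a fixed cube.  Letting M tend to
    infinity gives the first bound, and (g, f) gives the second one. *)

From HB Require Import structures.
Require Import Defs.
From mathcomp Require Import all_boot all_order all_algebra.
From mathcomp Require Import complex ring lra.
From mathcomp Require Import all_classical all_reals all_analysis.
From mathcomp Require Import measurable_realfun ess_sup_inf.

Set Implicit Arguments.
Unset Strict Implicit.
Unset Printing Implicit Defensive.

Import Order.TTheory GRing.Theory Num.Theory.
Import numFieldNormedType.Exports.

Local Open Scope classical_set_scope.
Local Open Scope ring_scope.

(** * Fourier transform of a Gaussian on the line *)

(** The obstacle is the norm of f. Tubes have width M and slopes 1/M apart, so at height y_0 up to
    about max(1, 1/(delta |y_0|)) of them overlap in each of the n transverse directions. A factor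
    vanishing to order n at y_0 = 0 removes exactly this loss, and the M^n packets together stay
    bounded independently of M. The price is that the binomial expansion splits each packet into n +
    1 packets with alternating signs and frequencies delta apart, which endangers the positivity of
    the Fourier transform. The outward push by (n + 1) delta restores it: seen from the unit ball,
    every Gaussian profile in the normal direction is evaluated at least n + 1 units of length delta
    from its centre, where the profile with the nearest centre outweighs all the others and only a
    constant depending on n is lost. With delta = M^-2 the final inequality compares powers of M
    alone: n - 2 alpha against 2d/p + d/q. *)

Section gaussian_line.
Context {R : realType}.
Implicit Types (b c u phi t : R).

Definition gauss1 b c t : R := expR (- (pi * b * (t - c) ^+ 2)).

Lemma gauss1_gt0 b c t : 0 < gauss1 b c t.
Proof. exact: expR_gt0. Qed.

Lemma gauss1_ge0 b c t : 0 <= gauss1 b c t.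
Proof. exact: expR_ge0. Qed.

Lemma continuous_gauss1 b c : continuous (gauss1 b c).
Proof.
move=> t; apply: (cvg_comp _ expR); last exact: continuous_expR.
apply: (@cvgN _ R^o); apply: cvgM; first exact: cvg_cst.
apply: (cvg_comp (fun x => x - c) (fun x => x ^+ 2)).
  by apply: (@cvgB _ R^o) => //; [exact: cvg_id|exact: cvg_cst].
exact: sqr_continuous.
Qed.

Lemma measurable_gauss1 b c : measurable_fun setT (gauss1 b c).
Proof. by apply: continuous_measurable_fun; exact: continuous_gauss1. Qed.

(** The total mass is taken from the normal density; this profile has variance 1/(2 pi b). *)
Lemma gauss1_normal b c : 0 < b ->
  gauss1 b c = normal_fun c (Num.sqrt (2 * pi * b)^-1).
Proof.
move=> b0; apply/funext => t; rewrite /gauss1 /normal_fun; congr expR.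
have pi0 : 0 < pi :> R := pi_gt0 R.
rewrite sqr_sqrtr ?invr_ge0 ?mulr_ge0 ?ltW//.
by move: pi0; generalize (pi : R) => P P0; field; rewrite !gt_eqF.
Qed.

Lemma integral_gauss1 b c : 0 < b ->
  (\int[lebesgue_measure]_t (gauss1 b c t)%:E)%E = (Num.sqrt b^-1)%:E.
Proof.
move=> b0; have pi0 : 0 < pi :> R := pi_gt0 R.
set s := Num.sqrt (2 * pi * b)^-1.
have s0 : s != 0 by rewrite gt_eqF// sqrtr_gt0 invr_gt0 !mulr_gt0.
have := integral_normal_pdf c s; rewrite normal_pdfE//.
under eq_integral do rewrite EFinM.
rewrite ge0_integralZl//=; last 3 first.
- by apply/measurable_EFinP; exact: measurable_normal_fun.
- by move=> x _; rewrite lee_fin normal_fun_ge0.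
- by rewrite lee_fin normal_peak_ge0.
rewrite -gauss1_normal//.
have -> : normal_peak s = (Num.sqrt b^-1)^-1.
  rewrite /normal_peak; congr (Num.sqrt _)^-1.
  rewrite /s sqr_sqrtr ?invr_ge0 ?mulr_ge0 ?ltW//.
  by move: pi0; generalize (pi : R) => P P0; field; rewrite !gt_eqF.
set I := (\int[_]_t _)%E; set k := Num.sqrt b^-1 => h.
have k0 : k != 0 by rewrite gt_eqF// sqrtr_gt0 invr_gt0.
have : (k%:E * (k^-1%:E * I) = k%:E * 1)%E by rewrite h.
by rewrite muleA -EFinM divff// mul1e mule1.
Qed.

Lemma integrable_gauss1 b c : 0 < b ->
  (@lebesgue_measure R).-integrable setT (EFin \o gauss1 b c).
Proof.
move=> b0; apply/integrableP; split.
  by apply/measurable_EFinP; exact: measurable_gauss1.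
under eq_integral do rewrite /= ger0_norm ?expR_ge0//.
by rewrite integral_gauss1// ltry.
Qed.

Lemma gauss1_decay b c e : 0 < b -> 0 < e ->
  exists A, forall t, A <= `|t| -> gauss1 b c t <= e.
Proof.
move=> b0 e0; have pi0 : 0 < pi :> R := pi_gt0 R.
exists (`|c| + 1 + (pi * b * e)^-1) => t ht.
set k := (pi * b * e)^-1 in ht.
have k0 : 0 < k by rewrite invr_gt0 !mulr_gt0.
have tc : 1 + k <= `|t - c|.
  have := ler_normD (t - c) c; rewrite subrK; lra.
have tc2 : k <= (t - c) ^+ 2.
  rewrite -real_normK ?num_real//; nra.
rewrite /gauss1 expRN -[leRHS]invrK lef_pV2 ?posrE ?expR_gt0 ?invr_gt0//.
apply: (le_trans _ (expR_ge1Dx _)).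
have -> : e^-1 = pi * b * k 
  by rewrite /k; move: pi0; generalize (pi : R) => P P0; field; rewrite !gt_eqF.
by rewrite ler_wpDl// ler_pM2l// mulr_gt0.
Qed.

Lemma near_ler_natS (x : R) : \forall n \near \oo, x <= n.+1%:R.
Proof.
near=> n; apply: (@le_trans _ _ n%:R); last by rewrite ler_nat.
by near: n; exact: nbhs_infty_ger.
Unshelve. all: by end_near. Qed.

(** Integration by parts on the whole line: the fundamental theorem on growing intervals leaves
    boundary terms that vanish by decay, and dominated convergence passes to the limit. *)
Lemma integral_derive_eq0 (h h' : R -> R) :
  continuous h' -> (forall t, is_derive t (1 : R) h (h' t)) ->
  (@lebesgue_measure R).-integrable setT (EFin \o h') ->
  (forall e : R, 0 < e -> exists A, forall t, A <= `|t| -> `|h t| <= e) ->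
  (\int[lebesgue_measure]_t (h' t)%:E)%E = 0%E.
Proof.
move=> ch' dh ih' dec.
(* The endpoint n + 1 keeps the interval nondegenerate at n = 0, as [continuous_FTC2] asks. *)
pose I n := [set` `[- n.+1%:R, n.+1%:R : R]] : set (measurableTypeR R).
pose f n : measurableTypeR R -> \bar R := (EFin \o h') \_ (I n).
have mI n : measurable (I n) by exact: measurable_itv.
have mh : measurable_fun setT h' by exact: continuous_measurable_fun.
have mf n : measurable_fun setT (f n).
  have mh1 : measurable_fun (I n) (EFin \o h' : measurableTypeR R -> \bar R).
    by apply: (measurable_funS measurableT) => //; exact/measurable_EFinP.
  exact: (measurable_restrictT _ (mI n)).1 mh1.
have [||||_ _] := @dominated_convergence _ _ _ (@lebesgue_measure R) setT
   measurableT f (EFin \o h') (fun t => `|h' t|%:E) mf.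
- exact/measurable_EFinP.
- apply: aeW => t _; apply: cvg_near_cst.
  near=> n; rewrite /f patchE mem_set// /I /= in_itv/= -ler_norml.
  by near: n; exact: near_ler_natS.
- by have := integrable_abse ih'.
- apply: aeW => t n _; rewrite /f patchE; case: ifP => //= _.
  by rewrite lee_fin normr0.
move=> cvI.
have {}cvI : (\int[lebesgue_measure]_(t in I n) (h' t)%:E @[n --> \oo] -->
    (\int[lebesgue_measure]_t (h' t)%:E))%E.
  apply: cvg_trans cvI; apply: near_eq_cvg; near=> n.
  by rewrite [RHS]integral_mkcond.
apply: (cvg_unique _ cvI) => //.
have -> : (fun n => \int[lebesgue_measure]_(t in I n) (h' t)%:E)%E =
    (fun n => (h n.+1%:R - h (- n.+1%:R))%:E).
  apply/funext => n; have ch : continuous h.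
    by move=> x; apply: differentiable_continuous; apply/derivable1_diffP; case: (dh x).
  rewrite (@continuous_FTC2 _ h' h)//.
  - by rewrite (lt_trans (y := 0))// oppr_lt0.
  - exact: continuous_subspaceT.
  - split => [x _||]; first by case: (dh x).
    + exact/cvg_at_right_filter/ch.
    + exact/cvg_at_left_filter/ch.
  - by move=> x _; rewrite derive1E; case: (dh x).
apply/fine_cvgP; split; first exact: nearW.
apply/cvgrPdist_le => e e0; have [A hA] := dec (e / 2) (divr_gt0 e0 (ltr0n _ 2)).
near=> n; rewrite sub0r normrN /=.
have An : A <= n.+1%:R.
  by near: n; exact: near_ler_natS.
rewrite (le_trans (ler_normB _ _))// [leRHS]splitr lerD// hA// ?normrN ger0_norm//.
Unshelve. all: by end_near. Qed.

Lemma is_derive_gauss1 b c t :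
  is_derive t (1 : R) (gauss1 b c) (gauss1 b c t * - (2 * pi * b * (t - c))).
Proof.
rewrite /gauss1; apply: is_derive_eq.
rewrite /GRing.scale/=; ring.
Qed.

Lemma integrable_gauss1M b c (h : R -> R) : 0 < b -> measurable_fun setT h ->
  (forall t, `|h t| <= 1) ->
  (@lebesgue_measure R).-integrable setT (fun t => (gauss1 b c t * h t)%:E).
Proof.
move=> b0 mh h1; apply: (le_integrable _ _ _ (integrable_gauss1 c b0)) => //.
  by apply/measurable_EFinP/measurable_funM => //; exact: measurable_gauss1.
by move=> t _ /=; rewrite lee_fin normrM ler_piMr.
Qed.

(** Half of the exponent absorbs the linear factor. The right-hand side is the integrable majorant
    for differentiating under the integral sign. *)
Lemma gauss1_linear_le b c t : 0 < b ->
  gauss1 b c t * `|t - c| <= (1 + 2 / (pi * b)) * gauss1 (b / 2) c t.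
Proof.
move=> b0; have pi0 : 0 < pi :> R := pi_gt0 R.
set x := t - c; set k := pi * b / 2.
have k0 : 0 < k by rewrite divr_gt0// mulr_gt0.
have -> : gauss1 b c t = gauss1 (b / 2) c t * expR (- (k * x ^+ 2)).
  rewrite /gauss1 -expRD; congr expR; rewrite /k -/x.
  by generalize (pi : R) => P; field.
rewrite -mulrA [leRHS]mulrC ler_pM2l ?gauss1_gt0// expRN.
rewrite mulrC ler_pdivrMr ?expR_gt0//.
have -> : 2 / (pi * b) = k^-1 
  by rewrite /k; move: pi0; generalize (pi : R) => P P0; field; rewrite !gt_eqF.
have h := expR_ge1Dx (k * x ^+ 2).
have h2 : 1 + x ^+ 2 <= (1 + k^-1) * expR (k * x ^+ 2).
  apply: (@le_trans _ _ ((1 + k^-1) * (1 + k * x ^+ 2))); last first.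
    by rewrite ler_pM2l// addr_gt0// invr_gt0.
  have -> : (1 + k^-1) * (1 + k * x ^+ 2) = 1 + x ^+ 2 + (k^-1 + k * x ^+ 2).
    by field; rewrite gt_eqF.
  rewrite lerDl addr_ge0//; first by rewrite invr_ge0 ltW.
    by rewrite mulr_ge0 ?sqr_ge0// ltW.
apply: le_trans h2; rewrite -[x ^+ 2]real_normK ?num_real//.
have := sqr_ge0 (`|x| - 1); nra.
Qed.

(** The free phase covers sines as well, through phi = - pi / 2, and absorbs the contribution of the
    other coordinates when passing to R^n. *)
Definition gcos b c phi u t := gauss1 b c t * cos (2 * pi * (t - c) * u + phi).

Lemma is_derive_gcos_freq b c phi u t :
  is_derive u (1 : R) (fun u => gcos b c phi u t)
    (- (2 * pi) * ((t - c) * gauss1 b c t * sin (2 * pi * (t - c) * u + phi))).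
Proof.
rewrite /gcos; apply: is_derive_eq.
by rewrite /GRing.scale/=; generalize (pi : R) => P; ring.
Qed.

Lemma is_derive_gsin b c phi u t :
  is_derive t (1 : R) (fun t => gauss1 b c t * sin (2 * pi * (t - c) * u + phi))
    (2 * pi * u * gcos b c phi u t -
     2 * pi * b * ((t - c) * gauss1 b c t * sin (2 * pi * (t - c) * u + phi))).
Proof.
have h := is_derive_gauss1 b c t.
rewrite /gcos; apply: is_derive_eq.
by rewrite /GRing.scale/=; generalize (pi : R) => P; ring.
Qed.

Lemma continuous_wave (f : R -> R) c phi u : continuous f ->
  continuous (fun t => f (2 * pi * (t - c) * u + phi)).
Proof.
move=> cf t; apply: (@continuous_comp _ _ _ (fun t => 2 * pi * (t - c) * u + phi) f); last exact: cf.
apply: differentiable_continuous; apply/derivable1_diffP.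
exact: ex_derive.
Qed.

Lemma integrable_gcos b c phi u : 0 < b ->
  (@lebesgue_measure R).-integrable setT (fun t => (gcos b c phi u t)%:E).
Proof.
move=> b0; apply: integrable_gauss1M => //.
  apply: continuous_measurable_fun; apply: continuous_wave; exact: continuous_cos.
by move=> t; rewrite ler_norml cos_geN1 cos_le1.
Qed.

Lemma integrable_gsinM b c phi u : 0 < b ->
  (@lebesgue_measure R).-integrable setT
  (fun t => ((t - c) * gauss1 b c t * sin (2 * pi * (t - c) * u + phi))%:E).
Proof.
move=> b0; have pi0 : 0 < pi :> R := pi_gt0 R.
have b20 : 0 < b / 2 by rewrite divr_gt0.
have ig := integrableZl measurableT (1 + 2 / (pi * b)) (integrable_gauss1 c b20).
apply: (le_integrable _ _ _ ig) => //.
  apply/measurable_EFinP/measurable_funM; last first.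
    apply: continuous_measurable_fun; apply: continuous_wave; exact: continuous_sin.
  by apply: measurable_funM; [exact: measurable_funB|exact: measurable_gauss1].
move=> t _ /=; rewrite lee_fin [leRHS]ger0_norm; last first.
  by rewrite mulr_ge0 ?gauss1_ge0// ltW// addr_gt0// divr_gt0// mulr_gt0.
rewrite !normrM.
apply: le_trans (gauss1_linear_le c t b0).
rewrite [X in _ * X * _]ger0_norm ?gauss1_ge0// [X in X * _]mulrC.
rewrite ler_piMr ?mulr_ge0//; first exact/gauss1_ge0.
by rewrite ler_norml sin_geN1 sin_le1.
Qed.

(* Integration by parts: the sine integral is the derivative in u of the cosine
   integral, so the latter solves F' = - (2 pi u / b) F. *)
Lemma integral_gsinM b c phi u : 0 < b ->
  (\int[lebesgue_measure]_t ((t - c) * gauss1 b c t * sin (2 * pi * (t - c) * u + phi)) =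
   u / b * \int[lebesgue_measure]_t gcos b c phi u t)%R.
Proof.
move=> b0; have pi0 : 0 < pi :> R := pi_gt0 R.
have i1 := integrableZl measurableT (2 * pi * u) (integrable_gcos c phi u b0).
have i2 := integrableZl measurableT (2 * pi * b) (integrable_gsinM c phi u b0).
have h : (\int[lebesgue_measure]_t (2 * pi * u * gcos b c phi u t -
     2 * pi * b * ((t - c) * gauss1 b c t * sin (2 * pi * (t - c) * u + phi)))%:E = 0)%E.
  apply: (@integral_derive_eq0 (fun t => gauss1 b c t * sin (2 * pi * (t - c) * u + phi))).
- move=> t; apply: cvgB; apply: cvgM; try exact: cvg_cst.
    apply: cvgM; first exact: continuous_gauss1.
    exact: (@continuous_wave (@cos R) c phi u (@continuous_cos R) t).
  apply: cvgM; last exact: (@continuous_wave (@sin R) c phi u (@continuous_sin R) t).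
  apply: cvgM; last exact: continuous_gauss1.
  by apply: (@cvgB _ R^o); [exact: cvg_id|exact: cvg_cst].
- by move=> t; exact: is_derive_gsin.
- by have := integrableB measurableT i1 i2.
- move=> e e0; have [A hA] := gauss1_decay c b0 e0; exists A => t At.
  rewrite normrM (le_trans _ (hA _ At))// ger0_norm ?gauss1_ge0//.
  by rewrite ler_piMr ?gauss1_ge0// ler_norml sin_geN1 sin_le1.
have : (\int[lebesgue_measure]_t (2 * pi * u * gcos b c phi u t -
     2 * pi * b * ((t - c) * gauss1 b c t * sin (2 * pi * (t - c) * u + phi))) = 0)%R.
  by rewrite /Rintegral h.
rewrite RintegralB// !RintegralZl//; last 2 first.
- exact: integrable_gsinM.
- exact: integrable_gcos.
set C := \int[_]__ _; set S := \int[_]__ _.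
move: pi0; generalize (pi : R) => P P0 /eqP; rewrite subr_eq0 => /eqP e.
have : 2 * P * (u * C - b * S) = 0 by rewrite mulrBr !mulrA e subrr.
move/eqP; rewrite mulf_eq0 gt_eqF/= ?mulr_gt0// subr_eq0 => /eqP e2.
by rewrite mulrAC e2 mulrAC divff ?mul1r// gt_eqF.
Qed.

Lemma is_derive_integral_gcos b c phi u : 0 < b ->
  is_derive u (1 : R) (fun u => \int[lebesgue_measure]_t gcos b c phi u t)%R
   (- (2 * pi * u / b) * \int[lebesgue_measure]_t gcos b c phi u t)%R.
Proof.
move=> b0; have pi0 : 0 < pi :> R := pi_gt0 R.
have b20 : 0 < b / 2 by rewrite divr_gt0.
(* This majorant of the u-derivative does not depend on u, since the sine is bounded by 1. *)
have ig := integrableZl measurableT (2 * pi * (1 + 2 / (pi * b))) (integrable_gauss1 c b20).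
have D x y : partial1of2 (fun u t => gcos b c phi u t) x y =
   - (2 * pi) * ((y - c) * gauss1 b c y * sin (2 * pi * (y - c) * x + phi)).
  by rewrite partial1of2E; have [_ ->] := is_derive_gcos_freq b c phi x y.
have a1 x : `](u - 1), (u + 1)[%classic x -> (@lebesgue_measure R).-integrable setT
    (EFin \o gcos b c phi x) by move=> _; exact: integrable_gcos.
have a2 x y : `](u - 1), (u + 1)[%classic x -> [set: R] y -> derivable (gcos b c phi ^~ y) x 1.
  by move=> _ _; have [] := is_derive_gcos_freq b c phi x y.
have Iu : `](u - 1), (u + 1)[%classic u by rewrite /= in_itv/= gtrBl ltrDl ltr01.
have G0 y : 0 <= 2 * pi * (1 + 2 / (pi * b)) * gauss1 (b / 2) c y.
  apply: mulr_ge0; last exact: gauss1_ge0.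
  by rewrite ltW// mulr_gt0// ?mulr_gt0// addr_gt0// divr_gt0// mulr_gt0.
have a3 x y : `](u - 1), (u + 1)[%classic x -> [set: R] y -> `|partial1of2 (gcos b c phi) x y| <=
    2 * pi * (1 + 2 / (pi * b)) * gauss1 (b / 2) c y.
  move=> _ _; have p2 : 0 <= 2 * pi :> R by rewrite mulr_ge0// ltW.
  rewrite D normrM normrN (ger0_norm p2).
  rewrite -[leRHS]mulrA ler_pM2l ?mulr_gt0//.
  apply: le_trans (gauss1_linear_le c y b0); rewrite !normrM.
  rewrite [X in _ * X * _]ger0_norm ?gauss1_ge0// [X in X * _]mulrC.
  rewrite ler_piMr ?mulr_ge0//; first exact/gauss1_ge0.
  by rewrite ler_norml sin_geN1 sin_le1.
split.
  exact: (derivable_under_integral measurableT Iu a1 a2 G0 ig a3).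
rewrite -derive1E (differentiation_under_integral measurableT Iu a1 a2 G0 ig a3).
under eq_Rintegral do rewrite D.
rewrite RintegralZl//; last exact: integrable_gsinM.
rewrite integral_gsinM//; generalize (pi : R) => P; ring.
Qed.

Lemma is_derive_0_is_cst_line (F : R -> R) : (forall x, is_derive x (1 : R) F 0) ->
  forall x y, F x = F y.
Proof. by move=> h x y; exact: is_derive_0_is_cst. Qed.

Lemma integral_gcos b c phi u : 0 < b ->
  (\int[lebesgue_measure]_t (gcos b c phi u t)%:E)%E =
  (Num.sqrt b^-1 * expR (- (pi * u ^+ 2 / b)) * cos phi)%:E.
Proof.
move=> b0; have pi0 : 0 < pi :> R := pi_gt0 R.
rewrite -[LHS]fineK; last first.
  exact: (integrable_fin_num measurableT (integrable_gcos c phi u b0)).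
congr EFin; rewrite -[LHS]/(\int[lebesgue_measure]_t gcos b c phi u t)%R.
pose F u := (\int[lebesgue_measure]_t gcos b c phi u t)%R.
(* Integrating factor of F' = - (2 pi u / b) F: H is constant, and its value at 0 is the mass of the
   Gaussian times cos phi. *)
pose H u := F u * expR (pi * u ^+ 2 / b).
have dH x : is_derive x (1 : R) H 0.
  have dF : is_derive x (1 : R) F _ := is_derive_integral_gcos c phi x b0.
  rewrite /H; apply: is_derive_eq; rewrite -/(F x).
  by rewrite /GRing.scale/=; generalize (pi : R) => P; field; rewrite gt_eqF.
have F0 : F 0 = Num.sqrt b^-1 * cos phi.
  rewrite /F; under eq_Rintegral do rewrite /gcos mulr0 add0r.
  by rewrite RintegralZr//; [rewrite /Rintegral integral_gauss1|exact: integrable_gauss1].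
have := is_derive_0_is_cst_line dH u 0.
rewrite /H expr0n/= mulr0 mul0r expR0 mulr1 F0 => e.
rewrite -/(F u) mulrAC -e -(mulrA (F u)) -expRD.
have -> : pi * u ^+ 2 / b - pi * u ^+ 2 / b = 0 :> R by rewrite subrr.
by rewrite expR0 mulr1.
Qed.

End gaussian_line.

(** * Gaussian wave packets in R^n *)

Section rV_integration.
Context {R : realType}.
Implicit Types (a b s t u phi psi : R).
Local Notation leb := (@lebesgue_measure R).

Lemma measurable_rV_coordR n (i : 'I_n) :
  measurable_fun setT (fun x : 'rV[R]_n => x ord0 i).
Proof. exact: measurable_rV_coord. Qed.

Lemma ge0_integral_rVS n (f : 'rV[R]_n.+1 -> \bar R) :
  measurable_fun setT f -> (forall x, (0 <= f x)%E) ->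
  (\int[lebesgue_rV n.+1]_x f x =
   \int[leb]_t \int[lebesgue_rV n]_y f (rV_cons (t, y)))%E.
Proof.
move=> mf f0.
have e := ge0_integral_pushforward (@measurable_rV_cons R n)
  (leb \x lebesgue_rV n)%E (D := setT) (f := f) measurableT mf (fun x _ => f0 x).
transitivity (\int[(leb \x lebesgue_rV n)%E]_x (f \o @rV_cons R n) x)%E.
  exact: e.
rewrite fubini_tonelli1//; last by move=> z; exact: f0.
exact: measurableT_comp mf (@measurable_rV_cons R n).
Qed.

Lemma integral_rVS n (f : 'rV[R]_n.+1 -> \bar R) :
  (lebesgue_rV n.+1).-integrable setT f ->
  (\int[lebesgue_rV n.+1]_x f x =
   \int[leb]_t \int[lebesgue_rV n]_y f (rV_cons (t, y)))%E.
Proof.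
move=> /integrableP[mf fi].
have mfc : measurable_fun setT (f \o @rV_cons R n).
  exact: measurableT_comp mf (@measurable_rV_cons R n).
have fi' : (leb \x lebesgue_rV n)%E.-integrable setT (f \o @rV_cons R n).
  apply/integrable12ltyP => //.
  rewrite -(ge0_integral_rVS (f := abse \o f))//; last by move=> z; exact: abse_ge0.
  exact: measurableT_comp.
have e := integral_pushforward (@measurable_rV_cons R n)
  (mu := (leb \x lebesgue_rV n)%E) (D := setT) (f := f) mf fi' measurableT.
transitivity (\int[(leb \x lebesgue_rV n)%E]_x (f \o @rV_cons R n) x)%E.
  exact: e.
by rewrite -integral12_prod_meas1.
Qed.

Lemma measurable_sqnorm n (c : 'rV[R]_n) :
  measurable_fun setT (fun x : 'rV[R]_n => sqnorm (x - c)).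
Proof.
apply: measurable_sum => i.
have h : measurable_fun setT (fun x : 'rV[R]_n => (x - c) ord0 i).
  under eq_fun do rewrite !mxE.
  by apply: measurable_funB => //; exact: measurable_rV_coordR.
exact: measurable_funM.
Qed.

Lemma dot_cons n (t s : R) (y z : 'rV[R]_n) :
  dot (rV_cons (t, y)) (rV_cons (s, z)) = t * s + dot y z.
Proof.
rewrite /dot big_ord_recl !mxE unlift_none/=; congr +%R.
by apply: eq_bigr => i _; rewrite !mxE liftK.
Qed.

Lemma rV_cons0 n (p : R * 'rV[R]_n) : rV_cons p ord0 ord0 = p.1.
Proof. by rewrite mxE unlift_none. Qed.

Lemma rV_consB n (t s : R) (y z : 'rV[R]_n) :
  rV_cons (t, y) - rV_cons (s, z) = rV_cons (t - s, y - z).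
Proof. by apply/rowP => i; rewrite !mxE; case: unliftP => [j|] _ //=; rewrite !mxE. Qed.

Lemma sqnorm_cons n (t : R) (y : 'rV[R]_n) :
  sqnorm (rV_cons (t, y)) = t ^+ 2 + sqnorm y.
Proof. by rewrite /sqnorm dot_cons. Qed.

Definition gauss n b (c x : 'rV[R]_n) : R := expR (- (pi * b * sqnorm (x - c))).

Lemma gauss_ge0 n b (c x : 'rV[R]_n) : 0 <= gauss b c x.
Proof. exact: expR_ge0. Qed.

Lemma measurable_gauss n b (c : 'rV[R]_n) : measurable_fun setT (gauss b c).
Proof.
apply: measurableT_comp => //; apply: measurableT_comp => //.
by apply: measurable_funM => //; exact: measurable_sqnorm.
Qed.

Lemma gauss_cons n b s t (c x : 'rV[R]_n) :
  gauss b (rV_cons (s, c)) (rV_cons (t, x)) = gauss1 b s t * gauss b c x.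
Proof.
rewrite /gauss rV_consB sqnorm_cons /gauss1 -expRD; congr expR.
by generalize (pi : R) => P; ring.
Qed.

Lemma integral_gauss n b (c : 'rV[R]_n) : 0 < b ->
  (\int[lebesgue_rV n]_x (gauss b c x)%:E)%E = (Num.sqrt b^-1 ^+ n)%:E.
Proof.
move=> b0; elim: n c => [|n IH] c.
  rewrite /= integral_dirac//=; last by apply/measurable_EFinP; exact: measurable_gauss.
  by rewrite diracT mul1e /gauss /sqnorm /dot big_ord0 mulr0 oppr0 expR0.
rewrite -[c]rV_unconsK; case: (rV_uncons c) => s e.
rewrite ge0_integral_rVS; last 2 first.
- apply/measurable_EFinP; exact: measurable_gauss.
- by move=> x; rewrite lee_fin gauss_ge0.
under eq_integral => t _.
  under eq_integral do rewrite gauss_cons EFinM.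
  rewrite ge0_integralZl//=; last 3 first.
  - apply/measurable_EFinP; exact: measurable_gauss.
  - by move=> x _; rewrite lee_fin gauss_ge0.
  - by rewrite lee_fin gauss1_ge0.
  rewrite IH.
  over.
rewrite ge0_integralZr//=; last 2 first.
- by apply/measurable_EFinP; exact: measurable_gauss1.
- by move=> x _; rewrite lee_fin gauss1_ge0.
by rewrite integral_gauss1// -EFinM exprS.
Qed.

Lemma integrable_gauss n b (c : 'rV[R]_n) : 0 < b ->
  (lebesgue_rV n).-integrable setT (EFin \o gauss b c).
Proof.
move=> b0; apply/integrableP; split.
  apply/measurable_EFinP; exact: measurable_gauss.
under eq_integral do rewrite /= ger0_norm ?expR_ge0//.
by rewrite integral_gauss// ltry.
Qed.

Lemma measurable_cos_dot n (c z : 'rV[R]_n) phi :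
  measurable_fun setT (fun x : 'rV[R]_n => cos (2 * pi * dot (x - c) z + phi)).
Proof.
apply: (@measurableT_comp _ _ _ _ _ _ (@cos R)).
  by apply: continuous_measurable_fun; exact: continuous_cos.
apply: measurable_funD => //; apply: measurable_funM => //.
apply: measurable_sum => i.
under eq_fun do rewrite !mxE.
by apply: measurable_funM => //; apply: measurable_funB => //; exact: measurable_rV_coordR.
Qed.

Lemma integrableM_le1 d (T : measurableType d) (mu : {measure set T -> \bar R})
    (f h : T -> R) :
  mu.-integrable setT (EFin \o f) -> measurable_fun setT h ->
  (forall z, `|h z| <= 1) -> mu.-integrable setT (fun z => (f z * h z)%:E).
Proof.
move=> fi mh h1; apply: (le_integrable _ _ _ fi) => //.
  apply/measurable_EFinP/measurable_funM => //.
  by case/integrableP: fi => /measurable_EFinP.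
by move=> t _ /=; rewrite lee_fin normrM ler_piMr.
Qed.

Lemma norm_cos_le1 (x : R) : `|cos x| <= 1.
Proof. by rewrite ler_norml cos_geN1 cos_le1. Qed.

(** Induction on n by Fubini. The term of the cosine coming from the first coordinate becomes part
    of the phase of the remaining ones, so the induction runs over all phases. *)
Lemma integral_gauss_cos n b (c z : 'rV[R]_n) phi : 0 < b ->
  (\int[lebesgue_rV n]_x (gauss b c x * cos (2 * pi * dot (x - c) z + phi))%:E)%E =
  (Num.sqrt b^-1 ^+ n * expR (- (pi * sqnorm z / b)) * cos phi)%:E.
Proof.
move=> b0; elim: n c z phi => [|n IH] c z phi.
  rewrite /= integral_dirac//=; last first.
    apply/measurable_EFinP/measurable_funM; first exact: measurable_gauss.
    exact: measurable_cos_dot.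
  rewrite diracT mul1e /gauss /sqnorm /dot !big_ord0 !mulr0 oppr0 expR0 !mul1r.
  by rewrite add0r mul0r oppr0 expR0 mul1r.
have ig : forall m (e w : 'rV[R]_m) psi, (lebesgue_rV m).-integrable setT
    (fun x => (gauss b e x * cos (2 * pi * dot (x - e) w + psi))%:E).
  move=> m e w psi; apply: integrableM_le1; first exact: integrable_gauss.
    exact: measurable_cos_dot.
  by move=> t; exact: norm_cos_le1.
rewrite integral_rVS; last exact: ig.
rewrite -[c]rV_unconsK -[z]rV_unconsK; case: (rV_uncons c) => s e; case: (rV_uncons z) => u w.
pose K := Num.sqrt b^-1 ^+ n * expR (- (pi * sqnorm w / b)).
have inner t : (\int[lebesgue_rV n]_y (gauss b (rV_cons (s, e)) (rV_cons (t, y)) *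
    cos (2 * pi * dot (rV_cons (t, y) - rV_cons (s, e)) (rV_cons (u, w)) + phi))%:E =
    (K%:E * (gcos b s phi u t)%:E))%E.
  transitivity ((gauss1 b s t)%:E * \int[lebesgue_rV n]_y
      (gauss b e y * cos (2 * pi * dot (y - e) w + (2 * pi * (t - s) * u + phi)))%:E)%E.
    rewrite -(integralZl measurableT (ig _ _ _ _)).
    apply: eq_integral => y _; rewrite gauss_cons rV_consB dot_cons -EFinM -mulrA.
    by congr (_ * (_ * cos _))%:E; generalize (pi : R) => P; ring.
  rewrite IH -!EFinM /gcos -/K; congr EFin; ring.
under eq_integral do rewrite inner.
rewrite (integralZl measurableT (integrable_gcos _ _ _ b0)).
rewrite integral_gcos// -EFinM sqnorm_cons (exprS _ n); congr EFin.
rewrite (_ : - (pi * (u ^+ 2 + sqnorm w) / b) = - (pi * u ^+ 2 / b) - (pi * sqnorm w / b)).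
  by rewrite expRD /K; ring.
by generalize (pi : R) => P; field; rewrite gt_eqF.
Qed.

(* A Gaussian concentrated on the tube of direction (1, theta); it is a shear,
   not a rotation, of a product Gaussian, so Fubini alone gives its Fourier
   transform. *)
Definition packet n a b (theta : 'rV[R]_n) (y : 'rV[R]_n.+1) : R :=
  gauss1 a 0 (y ord0 ord0) * gauss b (y ord0 ord0 *: theta) (rV_uncons y).2.

Lemma packet_cons n a b (theta : 'rV[R]_n) t y :
  packet a b theta (rV_cons (t, y)) = gauss1 a 0 t * gauss b (t *: theta) y.
Proof. by rewrite /packet rV_consK mxE unlift_none. Qed.

Lemma packet_ge0 n a b (theta : 'rV[R]_n) y : 0 <= packet a b theta y.
Proof. by apply: mulr_ge0; [exact: gauss1_ge0|exact: gauss_ge0]. Qed.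

Lemma measurable_packet n a b (theta : 'rV[R]_n) : measurable_fun setT (packet a b theta).
Proof.
apply: measurable_funM.
  exact: measurableT_comp (measurable_gauss1 _ _) (measurable_rV_coordR _).
apply: measurableT_comp => //; apply: measurableT_comp => //.
apply: measurable_funM => //; apply: measurable_sum => i.
have h : measurable_fun setT (fun x : 'rV[R]_n.+1 =>
    ((rV_uncons x).2 - x ord0 ord0 *: theta) ord0 i).
  under eq_fun do rewrite !mxE.
  apply: measurable_funB; first exact: measurable_rV_coordR.
  by apply: measurable_funM => //; exact: measurable_rV_coordR.
exact: measurable_funM.
Qed.

Lemma integrable_packet n a b (theta : 'rV[R]_n) : 0 < a -> 0 < b ->
  (lebesgue_rV n.+1).-integrable setT (EFin \o packet a b theta).
Proof.
move=> a0 b0; apply/integrableP; split.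
  apply/measurable_EFinP; exact: measurable_packet.
under eq_integral do rewrite /= ger0_norm ?packet_ge0//.
rewrite ge0_integral_rVS; last 2 first.
- apply/measurable_EFinP; exact: measurable_packet.
- by move=> x; rewrite lee_fin packet_ge0.
under eq_integral => t _.
  under eq_integral do rewrite packet_cons EFinM.
  rewrite ge0_integralZl//=; last 3 first.
  - apply/measurable_EFinP; exact: measurable_gauss.
  - by move=> x _; rewrite lee_fin gauss_ge0.
  - by rewrite lee_fin gauss1_ge0.
  rewrite integral_gauss//.
  over.
rewrite ge0_integralZr//=; last 2 first.
- by apply/measurable_EFinP; exact: measurable_gauss1.
- by move=> x _; rewrite lee_fin gauss1_ge0.
by rewrite integral_gauss1// -EFinM ltry.
Qed.

(** The Fourier transform of [packet], again a sheared Gaussian: of thickness a^(1/2) in the linear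
    form (1, theta) . z and of width b^(1/2) in the other coordinates. For a = delta^2, b = delta
    this is the shape of a cap of the sphere with normal (1, theta). *)
Definition packet_hat n a b (theta : 'rV[R]_n) (z : 'rV[R]_n.+1) : R :=
  Num.sqrt a^-1 * Num.sqrt b^-1 ^+ n *
  expR (- (pi * (z ord0 ord0 + dot theta (rV_uncons z).2) ^+ 2 / a)) *
  expR (- (pi * sqnorm (rV_uncons z).2 / b)).

Lemma integrable_packet_cos n a b (theta : 'rV[R]_n) z phi : 0 < a -> 0 < b ->
  (lebesgue_rV n.+1).-integrable setT
    (fun y => (packet a b theta y * cos (2 * pi * dot y z + phi))%:E).
Proof.
move=> a0 b0; apply: integrableM_le1; first exact: integrable_packet.
  by have := @measurable_cos_dot n.+1 0 z phi; under eq_fun do rewrite subr0.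
by move=> t; exact: norm_cos_le1.
Qed.

Lemma integral_packet_cos n a b (theta : 'rV[R]_n) z phi : 0 < a -> 0 < b ->
  (\int[lebesgue_rV n.+1]_y (packet a b theta y * cos (2 * pi * dot y z + phi))%:E)%E =
  (packet_hat a b theta z * cos phi)%:E.
Proof.
move=> a0 b0.
rewrite integral_rVS; last exact: integrable_packet_cos.
rewrite -[z]rV_unconsK /packet_hat rV_consK; case: (rV_uncons z) => u w.
rewrite rV_cons0 /=.
have ig m e v psi : (lebesgue_rV m).-integrable setT
    (fun x => (gauss b e x * cos (2 * pi * dot (x - e) v + psi))%:E).
  apply: integrableM_le1; first exact: integrable_gauss.
    exact: measurable_cos_dot.
  by move=> t; exact: norm_cos_le1.
pose K := Num.sqrt b^-1 ^+ n * expR (- (pi * sqnorm w / b)).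
have inner t : (\int[lebesgue_rV n]_y (packet a b theta (rV_cons (t, y)) *
    cos (2 * pi * dot (rV_cons (t, y)) (rV_cons (u, w)) + phi))%:E =
    (K%:E * (gcos a 0 phi (u + dot theta w) t)%:E))%E.
  transitivity ((gauss1 a 0 t)%:E * \int[lebesgue_rV n]_y
      (gauss b (t *: theta) y * cos (2 * pi * dot (y - t *: theta) w +
         (2 * pi * (t - 0) * (u + dot theta w) + phi)))%:E)%E.
    rewrite -(integralZl measurableT (ig _ _ _ _)).
    apply: eq_integral => y _; rewrite packet_cons dot_cons -EFinM -mulrA.
    (* Recentring the transverse Gaussian at t theta is what adds [dot theta w] to the longitudinal
       frequency. *)
    have -> : dot y w = dot (y - t *: theta) w + t * dot theta w.
      rewrite /dot mulr_sumr -big_split/=; apply: eq_bigr => i _.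
      by rewrite !mxE; ring.
    by congr (_ * (_ * cos _))%:E; generalize (pi : R) => P; ring.
  rewrite integral_gauss_cos// -!EFinM /gcos -/K; congr EFin; ring.
under eq_integral do rewrite inner.
rewrite (integralZl measurableT (integrable_gcos _ _ _ a0)).
rewrite integral_gcos// -EFinM; congr EFin; rewrite /K; ring.
Qed.

End rV_integration.

(** * Schwartz functions *)

Section schwartz_class.
Context {R : realType} {d : nat}.
Local Notation Rd := 'rV[R]_d.
Implicit Types (c phi : R) (x z v : Rd) (u w q : Rd -> R).

Lemma dotDl x y z : dot (x + y) z = dot x z + dot y z :> R.
Proof. by rewrite /dot -big_split/=; apply: eq_bigr => i _; rewrite mxE mulrDl. Qed.

Lemma dotBr x y z : dot x (y - z) = dot x y - dot x z :> R.
Proof. by rewrite /dot -sumrB; apply: eq_bigr => i _; rewrite !mxE mulrBr. Qed.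

Lemma dotZl c x z : dot (c *: x) z = c * dot x z.
Proof. by rewrite /dot mulr_sumr; apply: eq_bigr => i _; rewrite mxE mulrA. Qed.

Lemma differentiable_dot z x : differentiable (fun x : Rd => dot x z) x.
Proof.
rewrite /dot -fct_sumE; apply: differentiable_sum => i.
apply: differentiableM; last exact: differentiable_cst.
exact: differentiable_coord.
Qed.

Lemma derive_dot z x v : 'D_v (fun x : Rd => dot x z) x = dot v z.
Proof.
have dl : linear (fun x : Rd => dot x z : R^o).
  by move=> k a b; rewrite dotDl dotZl.
pose dM := GRing.isLinear.Build _ _ _ _ _ dl.
pose dL : {linear Rd -> R^o} := HB.pack (fun x : Rd => dot x z : R^o) dM.
have dc : continuous dL.
  by move=> y; apply: differentiable_continuous; exact: differentiable_dot.
rewrite deriveE; last exact: differentiable_dot.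
by have -> : 'd (fun x : Rd => dot x z) x = 'd dL x by []; rewrite diff_lin.
Qed.

Lemma derive_compR (h h' : R -> R) w x v :
  (forall t, is_derive t (1 : R) h (h' t)) -> differentiable w x ->
  differentiable (h \o w) x /\ 'D_v (h \o w) x = 'D_v w x * h' (w x).
Proof.
move=> dh dw.
have dhw : differentiable h (w x).
  by apply/derivable1_diffP; case: (dh (w x)).
split; first exact: differentiable_comp.
rewrite deriveE; last exact: differentiable_comp.
rewrite diff_comp//= -(deriveE v dw) deriv1E; last by case: (dh (w x)).
by rewrite /= derive1E; case: (dh (w x)) => _ ->.
Qed.

Lemma is_derive_cos_affine phi (t : R) :
  is_derive t (1 : R) (fun t => cos (2 * pi * t + phi))
    (2 * pi * cos (2 * pi * t + (phi + pi / 2))).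
Proof.
apply: is_derive_eq; rewrite addrA cosDpihalf /GRing.scale/=.
by generalize (pi : R) => P; ring.
Qed.

(** A class that contains the monomials, is closed under directional derivatives and grows at most
    polynomially. All iterated derivatives of u e^q with u, q in it have the form w e^q, so the
    Schwartz property reduces to one bound. Sines need no constructor: differentiating a cosine
    shifts its phase by pi / 2. *)
Inductive trigpoly : (Rd -> R) -> Prop :=
| trigpoly_cst c : trigpoly (fun=> c)
| trigpoly_dot z : trigpoly (fun x => dot x z)
| trigpoly_cos z phi : trigpoly (fun x => cos (2 * pi * dot x z + phi))
| trigpolyD u w : trigpoly u -> trigpoly w -> trigpoly (fun x => u x + w x)
| trigpolyM u w : trigpoly u -> trigpoly w -> trigpoly (fun x => u x * w x).

Lemma trigpoly_coord i : trigpoly (fun x => x ord0 i).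
Proof.
have -> : (fun x => x ord0 i) = (fun x : Rd => dot x (delta_mx ord0 i)).
  apply/funext => x; rewrite /dot (bigD1 i)//= mxE !eqxx mulr1 big1 ?addr0// => j ji.
  by rewrite mxE (negbTE ji) andbF mulr0.
exact: trigpoly_dot.
Qed.

Lemma trigpolyX u n : trigpoly u -> trigpoly (fun x => u x ^+ n).
Proof.
move=> tu; elim: n => [|n IH].
  by under eq_fun do rewrite expr0; exact: trigpoly_cst.
by under eq_fun do rewrite exprS; exact: trigpolyM.
Qed.

Lemma trigpoly_sum n (f : 'I_n -> Rd -> R) :
  (forall i, trigpoly (f i)) -> trigpoly (fun x => \sum_(i < n) f i x).
Proof.
move=> tf; elim: n f tf => [|n IH] f tf.
  by under eq_fun do rewrite big_ord0; exact: trigpoly_cst.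
under eq_fun do rewrite big_ord_recr/=.
by apply: trigpolyD => //; exact: (IH (fun i => f (widen_ord (leqnSn n) i))).
Qed.

Lemma trigpoly_monomial (b : 'I_d -> nat) : trigpoly (monomial b).
Proof.
suff h n (f : 'I_n -> Rd -> R) : (forall i, trigpoly (f i)) ->
    trigpoly (fun x => \prod_(i < n) f i x).
  by apply: h => i; apply: trigpolyX; exact: trigpoly_coord.
move=> tf; elim: n f tf => [|n IH] f tf.
  by under eq_fun do rewrite big_ord0; exact: trigpoly_cst.
under eq_fun do rewrite big_ord_recr/=.
by apply: trigpolyM => //; exact: (IH (fun i => f (widen_ord (leqnSn n) i))).
Qed.

Lemma trigpoly_differentiable u : trigpoly u -> forall x, differentiable u x.
Proof.
elim=> {u} [c|z|z phi|u w _ IHu _ IHw|u w _ IHu _ IHw] x.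
- exact: differentiable_cst.
- exact: differentiable_dot.
- exact: (derive_compR 0 (is_derive_cos_affine phi) (differentiable_dot z x)).1.
- exact: differentiableD.
- exact: differentiableM.
Qed.

Lemma trigpoly_derive u v : trigpoly u ->
  exists2 w, trigpoly w & forall x, 'D_v u x = w x.
Proof.
elim=> {u} [c|z|z phi|u w tu [u' tu' hu] tw [w' tw' hw]|u w tu [u' tu' hu] tw [w' tw' hw]].
- by exists (fun=> 0); [exact: trigpoly_cst|move=> x; rewrite derive_cst].
- by exists (fun=> dot v z); [exact: trigpoly_cst|move=> x; rewrite derive_dot].
- exists (fun x => dot v z * (2 * pi * cos (2 * pi * dot x z + (phi + pi / 2)))).
    by do 2![apply: trigpolyM; first exact: trigpoly_cst]; exact: trigpoly_cos.
  move=> x; have [_] := derive_compR v (is_derive_cos_affine phi) (differentiable_dot z x).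
  by rewrite derive_dot.
- exists (fun x => u' x + w' x); first exact: trigpolyD.
  move=> x; rewrite -hu -hw deriveD//; apply: diff_derivable; exact: trigpoly_differentiable.
- exists (fun x => u x * w' x + w x * u' x).
    by apply: trigpolyD; exact: trigpolyM.
  move=> x; rewrite -hu -hw deriveM//; apply: diff_derivable; exact: trigpoly_differentiable.
Qed.

Lemma sqnorm_ge0 x : 0 <= sqnorm x.
Proof. by apply: sumr_ge0 => i _; rewrite -expr2 sqr_ge0. Qed.

Lemma dot_le_sqnorm x z : `|dot x z| <= sqnorm x + sqnorm z.
Proof.
rewrite /sqnorm /dot -big_split/=; apply: (le_trans (ler_norm_sum _ _ _)).
apply: ler_sum => i _; rewrite normrM.
have := sqr_ge0 (`|x ord0 i| - `|z ord0 i|).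
rewrite -[x ord0 i * _]expr2 -[z ord0 i * _]expr2 -(@real_normK _ (x ord0 i)) ?num_real//.
by rewrite -(@real_normK _ (z ord0 i)) ?num_real//; nra.
Qed.

Lemma trigpoly_growth u : trigpoly u ->
  exists C m, 0 <= C /\ forall x, `|u x| <= C * (1 + sqnorm x) ^+ m.
Proof.
elim=> {u} [c|z|z phi|u w _ [C [m [C0 hC]]] _ [D [k [D0 hD]]]|u w _ [C [m [C0 hC]]] _ [D [k [D0 hD]]]].
- by exists `|c|, 0%N; split => // x; rewrite expr0 mulr1.
- exists (1 + sqnorm z), 1%N; split; first by rewrite addr_ge0 ?sqnorm_ge0.
  move=> x; rewrite expr1; apply: (le_trans (dot_le_sqnorm x z)).
  have := sqnorm_ge0 x; have := sqnorm_ge0 z; nra.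
- exists 1, 0%N; split => // x; rewrite expr0 mulr1; exact: norm_cos_le1.
- exists (C + D), (m + k)%N; split; first exact: addr_ge0.
  move=> x; have s1 : 1 <= 1 + sqnorm x by rewrite lerDl sqnorm_ge0.
  apply: (le_trans (ler_normD _ _)); rewrite mulrDl lerD//.
    apply: (le_trans (hC x)); rewrite ler_wpM2l// exprD ler_peMr ?exprn_ege1//.
    by rewrite exprn_ge0// (le_trans _ s1).
  apply: (le_trans (hD x)); rewrite ler_wpM2l// exprD ler_peMl ?exprn_ege1//.
  by rewrite exprn_ge0// (le_trans _ s1).
- exists (C * D), (m + k)%N; split; first exact: mulr_ge0.
  move=> x; rewrite normrM exprD mulrACA.
  by apply: ler_pM.
Qed.

(** Each factor 1 + t is paid for with half of the exponential rate, so the induction on m runs over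
    all rates. *)
Lemma exprn_expR_bounded (e : R) m : 0 < e ->
  exists K, forall t, 0 <= t -> (1 + t) ^+ m * expR (- (e * t)) <= K.
Proof.
move=> e0; elim: m => [|m IH] in e e0 *.
  exists 1 => t t0; rewrite expr0 mul1r -expR0 ler_expR oppr_le0.
  by rewrite mulr_ge0// ltW.
have e20 : 0 < e / 2 by rewrite divr_gt0.
have [K hK] := IH _ e20.
exists ((1 + (e / 2)^-1) * K) => t t0.
have h1 : (1 + t) * expR (- (e / 2 * t)) <= 1 + (e / 2)^-1.
  rewrite expRN ler_pdivrMr ?expR_gt0//.
  apply: (@le_trans _ _ ((1 + (e / 2)^-1) * (1 + e / 2 * t))).
    rewrite mulrDl mul1r mulrDr mulr1 mulKf ?gt_eqF//.
    have : 0 <= (e / 2)^-1 by rewrite invr_ge0 ltW.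
    have : 0 <= e / 2 * t by rewrite mulr_ge0// ltW.
    lra.
  by rewrite ler_wpM2l ?expR_ge1Dx// addr_ge0// invr_ge0 ltW.
have -> : - (e * t) = - (e / 2 * t) + - (e / 2 * t) by field.
rewrite exprS expRD mulrACA ler_pM//.
- by rewrite mulr_ge0 ?expR_ge0// addr_ge0.
- by rewrite mulr_ge0 ?expR_ge0// exprn_ge0// addr_ge0.
- exact: hK.
Qed.

Lemma pderiv_trigpoly_exp q u (s : seq 'I_d) : trigpoly q -> trigpoly u ->
  exists2 w, trigpoly w & pderiv s (fun x => u x * expR (q x)) = fun x => w x * expR (q x).
Proof.
move=> tq tu; elim: s => [|i s [w tw IH]]; first by exists u.
set v : Rd := delta_mx ord0 i.
have [w' tw' hw] := trigpoly_derive v tw.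
have [q' tq' hq] := trigpoly_derive v tq.
exists (fun x => w' x + w x * q' x).
  by apply: trigpolyD => //; exact: trigpolyM.
rewrite /= IH; apply/funext => x.
have [de De] := derive_compR v (fun t => is_derive_expR t) (trigpoly_differentiable tq x).
rewrite deriveM; last 2 first.
- by apply: diff_derivable; exact: trigpoly_differentiable.
- exact: diff_derivable.
by rewrite De hw hq /GRing.scale/=; ring.
Qed.

Lemma schwartz_trigpoly_exp q u (e : R) : trigpoly q -> trigpoly u -> 0 < e ->
  (forall x, q x <= - (e * sqnorm x)) -> schwartz_real (fun x => u x * expR (q x)).
Proof.
move=> tq tu e0 qe; split.
  move=> s x; have [w tw ->] := pderiv_trigpoly_exp s tq tu.
  apply: differentiableM; first exact: trigpoly_differentiable.
  exact: (derive_compR 0 (fun t => is_derive_expR t) (trigpoly_differentiable tq x)).1.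
move=> b s; have [w tw ->] := pderiv_trigpoly_exp s tq tu.
have [C [m [C0 hC]]] := trigpoly_growth (trigpolyM (trigpoly_monomial b) tw).
have [K hK] := exprn_expR_bounded m e0.
exists (C * K) => x; rewrite mulrA normrM [X in _ * X]ger0_norm ?expR_ge0//.
apply: (@le_trans _ _ (C * (1 + sqnorm x) ^+ m * expR (- (e * sqnorm x)))).
  by apply: ler_pM => //; rewrite ?expR_ge0 ?ler_expR.
by rewrite -mulrA ler_wpM2l// hK ?sqnorm_ge0.
Qed.

Lemma schwartz_realD u w :
  schwartz_real u -> schwartz_real w -> schwartz_real (fun x => u x + w x).
Proof.
move=> [du bu] [dw bw].
have pD s : pderiv s (fun x => u x + w x) = fun x => pderiv s u x + pderiv s w x.
  elim: s => // i s IH; rewrite /= IH; apply/funext => x.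
  by rewrite deriveD//; apply: diff_derivable; [exact: du|exact: dw].
split=> [s x|b s]; first by rewrite pD; apply: differentiableD; [exact: du|exact: dw].
have [M hM] := bu b s; have [N hN] := bw b s; exists (M + N) => x.
by rewrite pD mulrDr (le_trans (ler_normD _ _))// lerD.
Qed.

Lemma schwartz_real0 : schwartz_real (fun _ : Rd => 0 : R).
Proof.
have p0 s : pderiv s (fun _ : Rd => 0 : R) = fun=> 0.
  by elim: s => // i s IH; rewrite /= IH; apply/funext => x; rewrite derive_cst.
split=> [s x|b s]; first by rewrite p0; exact: differentiable_cst.
by exists 0 => x; rewrite p0 mulr0 normr0.
Qed.

Lemma schwartz_real_sum (I : Type) (r : seq I) (f : I -> Rd -> R) :
  (forall i, schwartz_real (f i)) -> schwartz_real (fun x => \sum_(i <- r) f i x).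
Proof.
move=> sf; elim: r => [|i r IH].
  by under eq_fun do rewrite big_nil; exact: schwartz_real0.
by under eq_fun do rewrite big_cons; exact: schwartz_realD.
Qed.

End schwartz_class.

(** * Bounds for Lp norms *)

Section lp_bounds.
Context {R : realType}.

Section monotone.
Context dd (T : measurableType dd) (mu : {measure set T -> \bar R}).
Local Open Scope ereal_scope.

(* No measurability is needed: the integral of a nonnegative function is a
   supremum over the simple functions below it. *)
Lemma ge0_le_integral_nomeas (f g : T -> \bar R) :
  (forall x, 0 <= f x) -> (forall x, f x <= g x) ->
  \int[mu]_x f x <= \int[mu]_x g x.
Proof.
move=> f0 fg; rewrite !ge0_integralTE//; last by move=> x; exact: le_trans (fg x).
apply: le_ereal_sup => _ [h hf <-]; exists h => //= x.
exact: le_trans (hf x) (fg x).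
Qed.

(** This is what allows the image of an arbitrary operator to be compared with the indicator of a
    cube. *)
Lemma ge0_le_Lnorm (p : \bar R) (f g : T -> \bar R) : 1 <= p ->
  (forall x, 0 <= f x) -> (forall x, f x <= g x) -> Lnorm mu p f <= Lnorm mu p g.
Proof.
move=> p1 f0 fg; rewrite unlock; case: p p1 => [r|_|//].
  rewrite lee_fin => r1; have r0 : (0 < r)%R by rewrite (lt_le_trans _ r1).
  have rV : (0 <= r^-1)%R by rewrite invr_ge0 ltW.
  have I0 h : (0 <= \int[mu]_x `|h x| `^ r) by apply: integral_ge0 => x _; exact: poweR_ge0.
  apply: (gt0_ler_poweR rV); rewrite ?in_itv/= ?I0 ?leey//.
  apply: ge0_le_integral_nomeas => x; first exact: poweR_ge0.
  apply: (gt0_ler_poweR (ltW r0)); rewrite ?in_itv/= ?abse_ge0 ?leey//.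
  by rewrite !gee0_abs// (le_trans (f0 x)).
case: ifPn => // _; apply: le_ess_sup; apply: aeW => x /=.
by rewrite !gee0_abs// (le_trans (f0 x)).
Qed.

End monotone.

Variable d : nat.
Local Notation Rd := 'rV[R]_d.
Local Notation leb := (@lebesgue_rV R d).
Implicit Types (x : Rd).

Lemma normc_ge0 (z : R[i]) : 0 <= ComplexField.Normc.normc z.
Proof. by case: z => a b /=; exact: sqrtr_ge0. Qed.

Lemma lebesgue_rV_cube (c : R) : 0 <= c ->
  leb [set x | forall i, x ord0 i \in `[- c, c]] = ((2 * c) ^+ d)%:E.
Proof.
move=> c0; rewrite (@lebesgue_rV_box _ _ (fun=> [set` `[- c, c]]))//.
under eq_bigr do rewrite lebesgue_measure_itv/= lte_fin.
have -> : (if - c < c then (c%:E - (- c)%:E)%E else 0%E) = (2 * c)%:E.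
  case: ifPn => [_|]; first by rewrite -EFinB; congr EFin; ring.
  by rewrite -leNgt => cc; congr EFin; lra.
by rewrite prodEFin prodr_const card_ord.
Qed.

Lemma measurable_cube (c : R) : measurable [set x : Rd | forall i, x ord0 i \in `[- c, c]].
Proof.
have -> : [set x : Rd | forall i, x ord0 i \in `[- c, c]] =
    \bigcap_(i in [set: 'I_d]) ((fun x : Rd => x ord0 i) @^-1` [set` `[- c, c]]).
  by apply/seteqP; split => [x h i _|x h i]; [exact: h|exact: (h i I)].
apply: fin_bigcap_measurable => [|i _]; first exact: finite_finset.
by rewrite -[X in measurable X]setTI; apply: measurable_rV_coordR => //; exact: measurable_itv.
Qed.

(** The norm at p = +oo is defined by cases on whether the whole space has positive measure. *)
Lemma lebesgue_rV_setT_gt0 : (0 < leb setT)%E.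
Proof.
apply: (@lt_le_trans _ _ (leb [set x | forall i, x ord0 i \in `[- 1, 1]])).
  by rewrite lebesgue_rV_cube// lte_fin exprn_gt0// mulr_gt0.
by rewrite le_measure ?inE//; exact: measurable_cube.
Qed.

(** By monotonicity it is enough to treat the Gaussian itself, whose p-th power is a Gaussian of
    parameter p k t and mass (p k t)^(-d/2). The exponent is written with [fine p^-1] so that it
    becomes 0 at p = +oo. *)
Lemma Lpnorm_gauss_le (p : \bar R) (C k : R) : (1 <= p)%E -> 0 <= C -> 0 < k ->
  exists D, 0 <= D /\ forall t (f : Rd -> R[i]), 0 < t ->
    (forall x, ComplexField.Normc.normc (f x) <= C * expR (- (pi * (k * t) * sqnorm x))) ->
    (Lpnorm p f <= (D * t `^ (- (d%:R / 2 * fine p^-1)))%:E)%E.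
Proof.
move=> p1 C0 k0.
suff [D [D0 hD]] : exists D, 0 <= D /\ forall t : R, 0 < t ->
    (Lnorm leb p (fun x => (C * gauss (k * t) 0 x)%:E) <=
     (D * t `^ (- (d%:R / 2 * fine p^-1)))%:E)%E.
  exists D; split => // t f t0 hf; apply: le_trans (hD _ t0).
  apply: ge0_le_Lnorm => // x; first by rewrite lee_fin normc_ge0.
  by rewrite lee_fin /gauss subr0.
rewrite unlock; case: p p1 => [r|_|//]; last first.
  exists C; split => // t t0; rewrite lebesgue_rV_setT_gt0 invey /= mulr0 oppr0 powRr0 mulr1.
  apply/ess_supP; apply: aeW => x /=; rewrite lee_fin ger0_norm ?mulr_ge0 ?gauss_ge0//.
  rewrite ler_piMr// /gauss -expR0 ler_expR oppr_le0.
  by rewrite !mulr_ge0 ?pi_ge0 ?sqnorm_ge0// ltW.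
rewrite lee_fin => r1; have r0 : 0 < r by rewrite (lt_le_trans _ r1).
rewrite inver gt_eqF//=.
exists (C * (r * k) `^ (- (d%:R / 2 * r^-1))); split; first by rewrite mulr_ge0// powR_ge0.
move=> t t0; have rkt : 0 < r * (k * t) by rewrite !mulr_gt0.
have -> : (\int[leb]_x (`|(C * gauss (k * t) 0 x)%:E| `^ r) =
   (C `^ r * (r * (k * t)) `^ (- (d%:R / 2)))%:E)%E.
  transitivity (\int[leb]_x ((C `^ r)%:E * (gauss (r * (k * t)) 0 x)%:E))%E.
    apply: eq_integral => x _; rewrite /= ger0_norm ?mulr_ge0 ?gauss_ge0//.
    rewrite ?poweR_EFin -EFinM powRM ?gauss_ge0//; congr (_ * _)%:E.
    by rewrite /gauss -expRM; congr expR; generalize (pi : R) => P; ring.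
  rewrite ge0_integralZl//=; last 3 first.
  - by apply/measurable_EFinP; exact: measurable_gauss.
  - by move=> x _; rewrite lee_fin gauss_ge0.
  - by rewrite lee_fin powR_ge0.
  rewrite integral_gauss// -EFinM; congr (_ * _)%:E.
  rewrite -powR12_sqrt ?invr_ge0 ?ltW// -powR_inv1 ?ltW// -powRrM -powR_mulrn ?powR_ge0//.
  by rewrite -powRrM; congr (_ `^ _); field.
rewrite poweR_EFin lee_fin powRM ?powR_ge0// -!powRrM divff ?gt_eqF// powRr1//.
rewrite -[leRHS]mulrA ler_wpM2l// mulNr -powRM ?(ltW t0)//; first by rewrite (mulrA r).
by rewrite ltW// mulr_gt0.
Qed.

Lemma Lpnorm_ge_cube (p : \bar R) (c : R) : (1 <= p)%E -> 0 < c ->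
  exists D, 0 < D /\ forall (A : R) (f : Rd -> R[i]), 0 <= A ->
    (forall x, (forall i : 'I_d, x ord0 i \in `[- c, c]) -> A <= ComplexField.Normc.normc (f x)) ->
    ((D * A)%:E <= Lpnorm p f)%E.
Proof.
move=> p1 c0; pose Q : set Rd := [set x | forall i, x ord0 i \in `[- c, c]].
have mQ : measurable Q by exact: measurable_cube.
have QE : leb Q = ((2 * c) ^+ d)%:E by exact: (lebesgue_rV_cube (ltW c0)).
have Qpos : (0 < leb Q)%E by rewrite lebesgue_rV_cube ?ltW// lte_fin exprn_gt0// mulr_gt0.
suff [D [D0 hD]] : exists D, 0 < D /\ forall A : R, 0 <= A ->
    ((D * A)%:E <= Lnorm leb p (fun x => (A * \1_Q x)%:E))%E.
  exists D; split => // A f A0 hf; apply: le_trans (hD _ A0) _.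
  apply: ge0_le_Lnorm => // x; rewrite lee_fin indicE; first by rewrite mulr_ge0.
  case: (boolP (x \in Q)) => [|_]; last by rewrite mulr0 normc_ge0.
  by rewrite inE mulr1 => Qx; exact: hf.
rewrite unlock; case: p p1 => [r|_|//]; last first.
  exists 1; split => // A A0; rewrite lebesgue_rV_setT_gt0 mul1r leNgt; apply/negP => lA.
  (* An essential supremum below A would place Q inside a null set. *)
  have [N [mN N0 sub]] := ess_sup_ge leb (abse \o (fun x => (A * \1_Q x)%:E)).
  have : (leb Q <= leb N)%E.
    rewrite le_measure ?inE// => x Qx; apply: sub => /= h.
    have := le_lt_trans h lA; rewrite indicE mem_set// mulr1 lte_fin ger0_norm//.
    by rewrite ltxx.
  by rewrite [leRHS]N0 leNgt Qpos.
rewrite lee_fin => r1; have r0 : 0 < r by rewrite (lt_le_trans _ r1).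
(* The volume of the cube to the power 1/r. *)
exists (((2 * c) ^+ d) `^ r^-1); split.
  by rewrite powR_gt0// exprn_gt0// mulr_gt0.
move=> A A0.
have -> : (\int[leb]_x (`|(A * \1_Q x)%:E| `^ r) = (A `^ r * (2 * c) ^+ d)%:E)%E.
  transitivity (\int[leb]_x ((A `^ r)%:E * (\1_Q x)%:E))%E.
    apply: eq_integral => x _; rewrite /= ger0_norm ?mulr_ge0//.
    rewrite ?poweR_EFin -EFinM powRM//; congr (_ * _)%:E; rewrite indicE.
    by case: (x \in Q); rewrite ?powR1// powR0// gt_eqF.
  rewrite ge0_integralZl//=; last 2 first.
  - by apply/measurable_EFinP; exact: measurable_indic.
  - by rewrite lee_fin powR_ge0.
  have -> : (\int[leb]_x (\1_Q x)%:E = leb Q)%E by rewrite integral_indic// setIT.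
  by rewrite QE -EFinM.
have c2 : 0 <= (2 * c) ^+ d by rewrite exprn_ge0// mulr_ge0// ltW.
by rewrite poweR_EFin lee_fin powRM ?powR_ge0// -powRrM divff ?gt_eqF// powRr1// mulrC.
Qed.

End lp_bounds.

(** * Overlap of the packets *)

Section lattice_sum.
Context {R : realType}.
Implicit Types (a b x t : R).

(** By the mean value theorem the increment is b / (1 + c^2) with |c - x| <= 1, and then 1 + c^2 <=
    3 + 2 x^2 <= 3 (1 + x^2). *)
Lemma atan_shift_ge x b : 0 <= b <= 1 -> b / (1 + x ^+ 2) <= 3 * (atan (x + b) - atan x).
Proof.
move=> /andP[b0 b1].
have dA z : z \in `]x, (x + b)[ -> is_derive z (1 : R) (@atan R) ((1 + z ^+ 2)^-1).
  by move=> _; exact: is_derive1_atan.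
have cA : {within `[x, x + b], continuous (@atan R)}.
  by apply: continuous_subspaceT => z; exact: continuous_atan.
have xb : x <= x + b by rewrite lerDl.
have [c] := MVT_segment xb dA cA.
rewrite in_itv/= => /andP[xc cb] ->; rewrite addrAC subrr add0r mulrA [leLHS]mulrC.
rewrite ler_wpM2r// ler_pdivlMr ?ltr_wpDr ?sqr_ge0// mulrC ler_pdivrMr ?ltr_wpDr ?sqr_ge0//.
have -> : c = x + (c - x) by ring.
have : 0 <= c - x by lra.
have : c - x <= 1 by lra.
set s := c - x => s1 s0.
have := sqr_ge0 (x - s); have := sqr_ge0 x; nra.
Qed.

(* By [atan_shift_ge] the sum is dominated by a telescoping sum of arctangents. *)
Lemma lattice_sum_le a b (M : nat) :
  Num.min 1 `|b| * \sum_(j < M) (1 + (a - b * j%:R) ^+ 2)^-1 <= 3 * pi.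
Proof.
wlog b0 : a b / 0 <= b => [hw|].
  have [|b0] := leP 0 b; first exact: hw.
  have := hw (- a) (- b); rewrite oppr_ge0 ltW// normrN => /(_ isT).
  congr (_ * _ <= _); apply: eq_bigr => j _; congr (1 + _)^-1.
  by rewrite -sqrrN; congr (_ ^+ 2); ring.
rewrite ger0_norm// mulr_sumr.
set m := Num.min 1 b.
have m0 : 0 <= m by rewrite le_min b0 ler01.
have m1 : m <= 1 by rewrite ge_min lexx.
have mb : m <= b by rewrite ge_min lexx orbT.
apply: (@le_trans _ _ (\sum_(j < M) 3 * (atan (b * j.+1%:R - a) - atan (b * j%:R - a)))).
  apply: ler_sum => j _; rewrite -[(a - _) ^+ 2]sqrrN opprB.
  apply: (le_trans (atan_shift_ge _ _)); first by rewrite m0.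
  (* The increment m had to be at most 1 for [atan_shift_ge]; enlarging it now to the full step b
     makes the sum telescope, with total at most the length pi of the range of the arctangent. *)
  rewrite ler_pM2l// lerD2r; apply: le_atan.
  by rewrite -natr1; lra.
rewrite -mulr_sumr ler_pM2l//.
rewrite -(big_mkord xpredT (fun j => atan (b * j.+1%:R - a) - atan (b * j%:R - a))).
rewrite telescope_sumr//.
have := atan_ltpi2 (b * M%:R - a); have := atan_gtNpi2 (b * 0%:R - a); lra.
Qed.

Lemma norm_sin_le x : `|sin x| <= `|x|.
Proof.
wlog x0 : x / 0 <= x => [hw|].
  have [|x0] := leP 0 x; first exact: hw.
  by have := hw (- x); rewrite sinN !normrN; apply; rewrite oppr_ge0 ltW.
have dA z : z \in `]0, x[ -> is_derive z (1 : R) (@sin R) (cos z).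
  by move=> _; exact: is_derive_sin.
have cA : {within `[0, x], continuous (@sin R)}.
  by apply: continuous_subspaceT => z; exact: continuous_sin.
have [c] := MVT_segment x0 dA cA.
rewrite sin0 !subr0 => _ ->; rewrite normrM ler_piMl// norm_cos_le1//.
Qed.

(** The modulus equals 2 |sin (t / 2)|. *)
Lemma normc_1Bcexpi t : ComplexField.Normc.normc (1 - cexpi t) <= Num.min 2 `|t|.
Proof.
have -> : 1 - cexpi t = Complex (1 - cos t) (0 - sin t) by [].
rewrite /=; have -> : (1 - cos t) ^+ 2 + (0 - sin t) ^+ 2 = (2 * `|sin (t / 2)|) ^+ 2.
  have e1 : cos t = 1 - 2 * sin (t / 2) ^+ 2.
    have -> : t = (t / 2) *+ 2 by rewrite -mulr_natr; field.
    rewrite cos_mulr2n cos2sin2 -mulr_natr.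
    have -> : (t / 2) *+ 2 / 2 = t / 2 by rewrite -mulr_natr; field.
    ring.
  rewrite exprMn real_normK ?num_real// sub0r sqrrN sin2cos2 e1; ring.
rewrite sqrtr_sqr ger0_norm ?mulr_ge0// le_min; apply/andP; split.
  by rewrite ler_piMr// ler_norml sin_geN1 sin_le1.
apply: (@le_trans _ _ (2 * `|t / 2|)); first by rewrite ler_pM2l// norm_sin_le.
by rewrite normrM [`|2^-1|]ger0_norm// mulrCA divff// mulr1.
Qed.

(** Indexing by finite functions presents the grid of M^n slopes in [0, 1)^n as a product, so that a
    sum over it factors by [bigA_distr_bigA]. *)
Definition slope n M (k : {ffun 'I_n -> 'I_M}) : 'rV[R]_n := \row_i ((k i)%:R / M%:R).

Definition delta (M : nat) : R := M%:R^-1 ^+ 2.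

(** The exponent of the packet is pi (T^2 + S) with S the sum of the A_i^2. One half of S yields the
    product, through e^(- x) <= 1 / (1 + x) and pi / 2 >= 1; the other half together with T^2
    controls delta^2 |y|^2. *)
Lemma packet_slope_le n M (k : {ffun 'I_n -> 'I_M}) (y : 'rV[R]_n.+1) :
  (0 < n)%N -> (0 < M)%N ->
  packet (delta M ^+ 2) (delta M) (slope k) y <=
  expR (- (pi * ((4 * n%:R)^-1 * delta M ^+ 2) * sqnorm y)) *
  \prod_(i < n) (1 + ((rV_uncons y).2 ord0 i / M%:R - delta M * y ord0 ord0 * (k i)%:R) ^+ 2)^-1.
Proof.
move=> n0 M0; set dl := delta M.
have M1 : 0 < M%:R :> R by rewrite ltr0n.
have n1 : 1 <= n%:R :> R by rewrite ler1n.
have pi0 : 0 < pi :> R := pi_gt0 R.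
rewrite -[y]rV_unconsK; case: (rV_uncons y) => y0 z.
rewrite packet_cons rV_cons0 rV_consK sqnorm_cons /=.
pose A (i : 'I_n) := z ord0 i / M%:R - dl * y0 * (k i)%:R.
pose W (i : 'I_n) := dl * z ord0 i.
pose T := dl * y0.
have -> : gauss1 (dl ^+ 2) 0 y0 * gauss dl (y0 *: slope k) z =
    expR (- (pi * (T ^+ 2 + \sum_(i < n) A i ^+ 2))).
  rewrite /gauss1 /gauss -expRD; congr expR.
  have -> : \sum_(i < n) A i ^+ 2 = dl * sqnorm (z - y0 *: slope k) :> R.
    rewrite /sqnorm /dot mulr_sumr; apply: eq_bigr => i _; rewrite !mxE /A /dl /delta.
    by field; rewrite gt_eqF.
  by rewrite subr0 /T; move: (sqnorm _) => s; generalize (pi : R) => P; ring.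
(* A_i is M (W_i - T th) with 0 <= th <= 1 and M >= 1, so W_i can exceed |A_i| by at most |T|. *)
have hA i : W i ^+ 2 / 2 - T ^+ 2 <= A i ^+ 2.
  pose th := (k i)%:R / M%:R : R.
  have AE : A i = M%:R * (W i - T * th).
    by rewrite /A /W /T /th /dl /delta; field; rewrite gt_eqF.
  have th0 : 0 <= th by rewrite divr_ge0.
  have th1 : th <= 1 by rewrite ler_pdivrMr// mul1r ler_nat ltnW.
  have M2 : 1 <= M%:R ^+ 2 :> R by rewrite exprn_ege1// ler1n.
  rewrite AE (exprMn _ M%:R); have h1 : (W i - T * th) ^+ 2 <= M%:R ^+ 2 * (W i - T * th) ^+ 2.
    by rewrite ler_peMl// sqr_ge0.
  apply: le_trans h1; have h2 : (T * th) ^+ 2 <= T ^+ 2.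
    by rewrite exprMn ler_piMr ?sqr_ge0// expr_le1.
  apply: (@le_trans _ _ (W i ^+ 2 / 2 - (T * th) ^+ 2)); first by rewrite lerB.
  by have := sqr_ge0 (W i - 2 * (T * th)); nra.
set S := \sum_(i < n) A i ^+ 2.
have hS : (\sum_(i < n) W i ^+ 2) / 2 - n%:R * T ^+ 2 <= S.
  have : \sum_(i < n) (W i ^+ 2 / 2 - T ^+ 2) <= S by apply: ler_sum => i _; exact: hA.
  by rewrite sumrB sumr_const card_ord -mulr_suml -[T ^+ 2 *+ n]mulr_natl.
have S0 : 0 <= S by apply: sumr_ge0 => i _; exact: sqr_ge0.
(* The constant 4 n absorbs the loss n T^2 in [hS]: the second term is at most S / (2 n) + T^2 / 2 +
   T^2 / (4 n). *)
have hE : S / 2 + (4 * n%:R)^-1 * dl ^+ 2 * (y0 ^+ 2 + sqnorm z) <= T ^+ 2 + S.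
  have -> : (4 * n%:R)^-1 * dl ^+ 2 * (y0 ^+ 2 + sqnorm z) =
    (4 * n%:R)^-1 * (T ^+ 2 + \sum_(i < n) W i ^+ 2).
    have -> : \sum_(i < n) W i ^+ 2 = dl ^+ 2 * sqnorm z.
      by rewrite /sqnorm /dot mulr_sumr; apply: eq_bigr => i _; rewrite /W; ring.
    by rewrite /T; move: (_^-1) (sqnorm z) => u v; ring.
  move: hS; set w := \sum_(i < n) _ => hS.
  have n4 : 0 < 4 * n%:R :> R by rewrite mulr_gt0// (lt_le_trans _ n1).
  rewrite addrC -lerBrDr [_^-1 * _]mulrC ler_pdivrMr//.
  have := sqr_ge0 T; nra.
apply: (@le_trans _ _ (expR (- (pi * ((4 * n%:R)^-1 * dl ^+ 2 * (y0 ^+ 2 + sqnorm z)))) *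
     expR (- (pi / 2 * S)))).
  rewrite -expRD ler_expR -opprD lerN2.
  have -> : pi * ((4 * n%:R)^-1 * dl ^+ 2 * (y0 ^+ 2 + sqnorm z)) + pi / 2 * S =
     pi * (S / 2 + (4 * n%:R)^-1 * dl ^+ 2 * (y0 ^+ 2 + sqnorm z)).
    by generalize (pi : R) => P; ring.
  by rewrite ler_pM2l.
rewrite mulrA ler_wpM2l ?expR_ge0//.
rewrite /S mulr_sumr -sumrN expR_sum.
apply: ler_prod => i _; rewrite expR_ge0/= expRN -/(A i).
rewrite lef_pV2 ?posrE ?expR_gt0 ?ltr_wpDr ?sqr_ge0//.
apply: (le_trans _ (expR_ge1Dx _)); rewrite lerD2l ler_peMl ?sqr_ge0//.
exact: pihalf_ge1.
Qed.

(** The sum over slopes factors into n lattice sums of step delta y_0, and each of them uses up one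
    factor of the minimum. *)
Lemma packet_sum_le n M (y : 'rV[R]_n.+1) : (0 < n)%N -> (0 < M)%N ->
  Num.min 1 `|delta M * y ord0 ord0| ^+ n *
  \sum_(k : {ffun 'I_n -> 'I_M}) packet (delta M ^+ 2) (delta M) (slope k) y <=
  (3 * pi) ^+ n * expR (- (pi * ((4 * n%:R)^-1 * delta M ^+ 2) * sqnorm y)).
Proof.
move=> n0 M0; set m := Num.min _ _; set E := expR _.
have m0 : 0 <= m by rewrite le_min ler01 normr_ge0.
pose F (i : 'I_n) (j : 'I_M) : R :=
  (1 + ((rV_uncons y).2 ord0 i / M%:R - delta M * y ord0 ord0 * j%:R) ^+ 2)^-1.
apply: (@le_trans _ _ (m ^+ n * (E * \prod_(i < n) \sum_(j < M) F i j))).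
  rewrite ler_wpM2l ?exprn_ge0// bigA_distr_bigA mulr_sumr.
  by apply: ler_sum => k _; exact: packet_slope_le.
rewrite mulrCA [leRHS]mulrC ler_wpM2l ?expR_ge0//.
rewrite -[X in m ^+ X](card_ord n) -[X in _ <= _ ^+ X](card_ord n) -!prodr_const -big_split/=.
apply: ler_prod => i _; apply/andP; split; last exact: lattice_sum_le.
rewrite mulr_ge0//; apply: sumr_ge0 => j _; rewrite invr_ge0.
by rewrite addr_ge0// sqr_ge0.
Qed.

End lattice_sum.

(** * Linear combinations of packets *)

Section packet_combinations.
Context {R : realType} {n : nat} {I : finType}.
Local Notation Rd := 'rV[R]_n.+1.
Variables (a b : R) (c : I -> R) (theta : I -> 'rV[R]_n) (nu : I -> Rd).
Hypotheses (a0 : 0 < a) (b0 : 0 < b).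
Implicit Types (x y z xi : Rd).

(** The sum of c_i packet_i(y) e^(2 pi i y . nu_i). Its two parts are spelled out because both
    [schwartz] and [cintegral] refer to real and imaginary parts. *)
Definition comb y : R[i] :=
  Complex (\sum_i c i * packet a b (theta i) y * cos (2 * pi * dot y (nu i)))
          (\sum_i c i * packet a b (theta i) y * sin (2 * pi * dot y (nu i))).

Lemma cexpiD (s t : R) : cexpi (s + t) = cexpi s * cexpi t.
Proof. by rewrite /cexpi cosD sinD; congr Complex; rewrite addrC mulrC [X in X + _]mulrC. Qed.

Lemma Complex_sum (J : Type) (r : seq J) (f g : J -> R) :
  \sum_(j <- r) Complex (f j) (g j) = Complex (\sum_(j <- r) f j) (\sum_(j <- r) g j).
Proof.
elim: r => [|j r IH]; first by rewrite !big_nil.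
by rewrite !big_cons IH.
Qed.

Lemma combE y :
  comb y = \sum_i real_complex R (c i * packet a b (theta i) y) * cexpi (2 * pi * dot y (nu i)).
Proof.
rewrite /comb -Complex_sum; apply: eq_bigr => i _.
by rewrite /cexpi; congr Complex => /=; ring.
Qed.

Definition comb_hat xi : R := \sum_i c i * packet_hat a b (theta i) (nu i - xi).

Lemma Rintegral_packet_sum xi phi :
  (\int[lebesgue_rV n.+1]_y (\sum_i c i * (packet a b (theta i) y *
     cos (2 * pi * dot y (nu i - xi) + phi))) = comb_hat xi * cos phi)%R.
Proof.
rewrite /Rintegral.
transitivity (fine (\int[lebesgue_rV n.+1]_y \sum_i ((c i)%:E * (packet a b (theta i) y *
     cos (2 * pi * dot y (nu i - xi) + phi))%:E)))%E.
  by congr fine; apply: eq_integral => y _; rewrite -sumEFin.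
rewrite integral_sum//; last first.
  by move=> i; apply: integrableZl => //; exact: integrable_packet_cos.
under eq_bigr => i _.
  rewrite (integralZl measurableT (integrable_packet_cos _ _ _ a0 b0)).
  rewrite integral_packet_cos// -EFinM mulrA.
  over.
by rewrite sumEFin /= /comb_hat mulr_suml.
Qed.

(** The packets are even and the coefficients real, so the transform is real: the imaginary part is
    the same integral at phase - pi / 2, where the factor cos phi vanishes. *)
Lemma fourier_comb xi : fourier comb xi = real_complex R (comb_hat xi).
Proof.
have RE y : complex.Re (cexpi (- (2 * pi * dot y xi)) * comb y) =
    \sum_i c i * (packet a b (theta i) y * cos (2 * pi * dot y (nu i - xi) + 0)).
  rewrite /=; set T := - (2 * pi * dot y xi); rewrite !mulr_sumr -sumrB; apply: eq_bigr => i _.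
  have -> : 2 * pi * dot y (nu i - xi) + 0 = T + 2 * pi * dot y (nu i).
    by rewrite dotBr /T; generalize (pi : R) => P; ring.
  by rewrite cosD; ring.
have IE y : complex.Im (cexpi (- (2 * pi * dot y xi)) * comb y) =
    \sum_i c i * (packet a b (theta i) y * cos (2 * pi * dot y (nu i - xi) + - (pi / 2))).
  rewrite /=; set T := - (2 * pi * dot y xi); rewrite !mulr_sumr -big_split/=; apply: eq_bigr => i _.
  have -> : 2 * pi * dot y (nu i - xi) + - (pi / 2) =
      T + 2 * pi * dot y (nu i) - pi / 2.
    by rewrite dotBr /T; generalize (pi : R) => P; ring.
  by rewrite cosBpihalf sinD; ring.
rewrite /fourier /cintegral; congr Complex.
  under eq_Rintegral do rewrite RE.
  by rewrite Rintegral_packet_sum cos0 mulr1.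
under eq_Rintegral do rewrite IE.
by rewrite Rintegral_packet_sum cosN cos_pihalf mulr0.
Qed.

Definition packet_exponent i y : R :=
  - (pi * (a * y ord0 ord0 ^+ 2 + b * sqnorm ((rV_uncons y).2 - y ord0 ord0 *: theta i))).

Lemma packet_exponentE i y : packet a b (theta i) y = expR (packet_exponent i y).
Proof.
rewrite /packet /gauss1 /gauss -expRD subr0; congr expR; rewrite /packet_exponent.
by move: (sqnorm _) => s; generalize (pi : R) => P; ring.
Qed.

Lemma trigpoly_packet_exponent i : trigpoly (packet_exponent i).
Proof.
have -> : packet_exponent i = (fun y => (- pi) * (a * y ord0 ord0 ^+ 2 +
   b * \sum_(j < n) (y ord0 (lift ord0 j) + (- theta i ord0 j) * y ord0 ord0) ^+ 2)).
  apply/funext => y; rewrite /packet_exponent mulNr; congr (- (_ * (_ + _ * _))).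
  by rewrite /sqnorm /dot; apply: eq_bigr => j _; rewrite !mxE; ring.
apply: trigpolyM; first exact: trigpoly_cst.
apply: trigpolyD; apply: trigpolyM; try exact: trigpoly_cst.
  by apply: trigpolyX; exact: trigpoly_coord.
apply: trigpoly_sum => j; apply: trigpolyX; apply: trigpolyD; first exact: trigpoly_coord.
by apply: trigpolyM; [exact: trigpoly_cst|exact: trigpoly_coord].
Qed.

Lemma packet_exponent_le i : exists2 e, 0 < e &
  forall y, packet_exponent i y <= - (e * sqnorm y).
Proof.
have pi0 : 0 < pi :> R := pi_gt0 R.
pose K := 1 + 2 * sqnorm (theta i).
have K1 : 1 <= K by rewrite lerDl mulr_ge0 ?sqnorm_ge0.
have K0 : 0 < K := lt_le_trans ltr01 K1.
(* Both entries come from |z|^2 <= 2 |z - y_0 theta|^2 + 2 y_0^2 |theta|^2, which shows that the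
   sheared quadratic form is still positive definite. *)
pose e := Num.min (a / K) (b / 2).
have e0 : 0 < e by rewrite lt_min !divr_gt0.
have ea : e * K <= a by rewrite -ler_pdivlMr// ge_min lexx.
have eb : e * 2 <= b by rewrite -ler_pdivlMr// ge_min lexx orbT.
exists (pi * e); first exact: mulr_gt0.
move=> y; rewrite /packet_exponent lerN2 -mulrA ler_pM2l//.
rewrite -[y]rV_unconsK; case: (rV_uncons y) => y0 z.
rewrite rV_cons0 rV_consK sqnorm_cons /=.
set w := z - y0 *: theta i.
have hz : sqnorm z <= 2 * sqnorm w + 2 * y0 ^+ 2 * sqnorm (theta i).
  rewrite /sqnorm /dot !mulr_sumr -big_split/=; apply: ler_sum => j _.
  have -> : z ord0 j = w ord0 j + y0 * theta i ord0 j by rewrite !mxE; ring.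
  by have := sqr_ge0 (w ord0 j - y0 * theta i ord0 j); nra.
have := sqnorm_ge0 w; have := sqr_ge0 (y0 : R).
move: hz ea; rewrite /K; move: (sqnorm w) (sqnorm z) (sqnorm (theta i)) => A B D.
set T := y0 ^+ 2 => hz ea T0 A0.
have h1 := ler_wpM2l (ltW e0) hz; have h2 := ler_wpM2r T0 ea; have h3 := ler_wpM2r A0 eb.
nra.
Qed.

Lemma schwartz_comb : schwartz comb.
Proof.
split => /=; apply: schwartz_real_sum => i; have [e e0 he] := packet_exponent_le i.
- have -> : (fun y => c i * packet a b (theta i) y * cos (2 * pi * dot y (nu i))) =
    (fun y => (c i * cos (2 * pi * dot y (nu i) + 0)) * expR (packet_exponent i y)).
    by apply/funext => y; rewrite packet_exponentE addr0; ring.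
  apply: (schwartz_trigpoly_exp (trigpoly_packet_exponent i) _ e0 he).
  by apply: trigpolyM; [exact: trigpoly_cst|exact: trigpoly_cos].
- have -> : (fun y => c i * packet a b (theta i) y * sin (2 * pi * dot y (nu i))) =
    (fun y => (c i * cos (2 * pi * dot y (nu i) + - (pi / 2))) * expR (packet_exponent i y)).
    by apply/funext => y; rewrite packet_exponentE cosBpihalf; ring.
  apply: (schwartz_trigpoly_exp (trigpoly_packet_exponent i) _ e0 he).
  by apply: trigpolyM; [exact: trigpoly_cst|exact: trigpoly_cos].
Qed.

Lemma measurable_comb_hat : measurable_fun setT comb_hat.
Proof.
apply: measurable_sum => i; apply: measurable_funM => //.
have mc j : measurable_fun setT (fun xi : Rd => (nu i - xi) ord0 j).
  under eq_fun do rewrite !mxE.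
  by apply: measurable_funB => //; exact: measurable_rV_coordR.
apply: measurable_funM; last first.
  apply: measurableT_comp => //; apply: measurableT_comp => //.
  apply: measurable_funM => //; apply: measurable_funM => //.
  apply: measurable_sum => j; apply: measurable_funM.
    by under eq_fun do rewrite mxE; exact: mc.
  by under eq_fun do rewrite mxE; exact: mc.
apply: measurable_funM => //.
apply: measurableT_comp => //; apply: measurableT_comp => //.
apply: measurable_funM => //; apply: measurable_funM => //; apply: measurable_funX.
apply: measurable_funD; first exact: mc.
apply: measurable_sum => j; apply: measurable_funM => //.
by under eq_fun do rewrite mxE; exact: mc.
Qed.

Lemma comb_hat_bounded : exists2 K, 0 <= K & forall xi, `|comb_hat xi| <= K.
Proof.
exists (\sum_i `|c i| * (Num.sqrt a^-1 * Num.sqrt b^-1 ^+ n)).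
  by apply: sumr_ge0 => i _; rewrite !mulr_ge0.
move=> xi; apply: (le_trans (ler_norm_sum _ _ _)); apply: ler_sum => i _.
rewrite normrM ler_wpM2l// /packet_hat -mulrA normrM ger0_norm ?mulr_ge0//.
rewrite ler_piMr ?mulr_ge0// -expRD ger0_norm ?expR_ge0//.
rewrite -expR0 ler_expR -opprD oppr_le0.
apply: addr_ge0; apply: divr_ge0; try exact: ltW; apply: mulr_ge0; try exact: pi_ge0.
  exact: sqr_ge0.
exact: sqnorm_ge0.
Qed.

End packet_combinations.

(** * Lower bound for the bilinear operator *)

Section bilinear_lower_bound.
Context {R : realType}.
Implicit Types (alpha : R).

(** 1 - cos t is the real part of 1 - e^(i t), whose modulus is at most |t|. *)
Lemma cos_ge_half (t : R) : `|t| <= 2^-1 -> 2^-1 <= cos t.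
Proof.
move=> ht; have := normc_1Bcexpi t; rewrite le_min => /andP[_ h].
have h1 : 1 - cos t <= ComplexField.Normc.normc (1 - cexpi t).
  have -> : 1 - cexpi t = Complex (1 - cos t) (0 - sin t) by [].
  rewrite /= (le_trans (ler_norm _))// -sqrtr_sqr ler_wsqrtr// lerDl sqr_ge0//.
have : 1 - cos t <= 2^-1 by apply: le_trans h1 (le_trans h ht).
lra.
Qed.

Section symbol.
Variable d : nat.
Local Notation Rd := 'rV[R]_d.
Local Notation leb := (@lebesgue_rV R d).
Implicit Types (x y xi eta : Rd).

Lemma coord_le_sqnorm x i : x ord0 i ^+ 2 <= sqnorm x.
Proof.
rewrite /sqnorm /dot (bigD1 i)//= -expr2 lerDl; apply: sumr_ge0 => j _.
by rewrite -expr2 sqr_ge0.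
Qed.

Lemma bochner_riesz_symbolC alpha xi eta :
  bochner_riesz_symbol alpha xi eta = bochner_riesz_symbol alpha eta xi.
Proof.
rewrite /bochner_riesz_symbol addrC; case: ifP => // _; congr (_ `^ _); ring.
Qed.

Lemma bochner_riesz_symbol_ge0 alpha xi eta : 0 <= bochner_riesz_symbol alpha xi eta.
Proof. by rewrite /bochner_riesz_symbol; case: ifP => // _; exact: powR_ge0. Qed.

Lemma bochner_riesz_symbol_le1 alpha xi eta : 0 <= alpha ->
  bochner_riesz_symbol alpha xi eta <= 1.
Proof.
move=> a0; rewrite /bochner_riesz_symbol; case: ifP => // h.
have x0 := sqnorm_ge0 xi; have e0 := sqnorm_ge0 eta.
have e : 1 `^ alpha = 1 :> R by rewrite powR1.
rewrite -[leRHS]e; apply: ge0_ler_powR => //; rewrite ?nnegrE; lra.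
Qed.

Lemma bochner_riesz_symbol_ge alpha xi eta (v : R) : 0 <= alpha -> 0 < v ->
  sqnorm xi + sqnorm eta <= 1 - v -> v `^ alpha <= bochner_riesz_symbol alpha xi eta.
Proof.
move=> a0 v0 h; rewrite /bochner_riesz_symbol ifT; last by lra.
apply: ge0_ler_powR => //; rewrite ?nnegrE; lra.
Qed.

Lemma measurable_sqnorm0 : measurable_fun setT (@sqnorm R d).
Proof. by have := @measurable_sqnorm R d 0; under eq_fun do rewrite subr0. Qed.

Lemma measurable_bochner_riesz_symbol alpha :
  measurable_fun setT (fun z : Rd * Rd => bochner_riesz_symbol alpha z.1 z.2).
Proof.
have m1 : measurable_fun setT (fun z : Rd * Rd => sqnorm z.1).
  exact: measurableT_comp measurable_sqnorm0 measurable_fst.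
have m2 : measurable_fun setT (fun z : Rd * Rd => sqnorm z.2).
  exact: measurableT_comp measurable_sqnorm0 measurable_snd.
rewrite /bochner_riesz_symbol; apply: measurable_fun_ifT => //.
- by apply: measurable_fun_ltr => //; exact: measurable_funD.
- apply: (measurableT_comp (measurable_powR alpha)).
  by apply: measurable_funB => //; exact: measurable_funB.
Qed.

Section fourier_real.
Variables (alpha : R) (f g : Rd -> R[i]) (F G : Rd -> R).
Hypotheses (alpha0 : 0 <= alpha)
  (fF : forall xi, fourier f xi = real_complex R (F xi))
  (gG : forall xi, fourier g xi = real_complex R (G xi))
  (mF : measurable_fun setT F) (mG : measurable_fun setT G)
  (bF : exists2 K, 0 <= K & forall xi, `|F xi| <= K)
  (bG : exists2 K, 0 <= K & forall xi, `|G xi| <= K)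
  (F0 : forall xi, sqnorm xi <= 1 -> 0 <= F xi)
  (G0 : forall xi, sqnorm xi <= 1 -> 0 <= G xi).

Let H (z : Rd * Rd) := bochner_riesz_symbol alpha z.1 z.2 * F z.1 * G z.2.

Let H_ge0 z : 0 <= H z.
Proof.
rewrite /H /bochner_riesz_symbol; case: ifP => h; last by rewrite !mul0r.
have x0 := sqnorm_ge0 z.1; have e0 := sqnorm_ge0 z.2.
rewrite mulr_ge0 ?G0//; last by lra.
rewrite mulr_ge0 ?F0 ?powR_ge0//; lra.
Qed.

Let measurable_H : measurable_fun setT H.
Proof.
apply: measurable_funM; last exact: measurableT_comp mG measurable_snd.
apply: measurable_funM; last exact: measurableT_comp mF measurable_fst.
exact: measurable_bochner_riesz_symbol.
Qed.

Let integrable_H : (leb \x leb)%E.-integrable setT (EFin \o H).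
Proof.
case: bF => KF KF0 hF; case: bG => KG KG0 hG.
pose Q : set Rd := [set x | forall i, x ord0 i \in `[- 1, 1]].
have mQ : measurable Q by exact: measurable_cube.
have QE : leb Q = ((2 * 1) ^+ d)%:E by exact: (lebesgue_rV_cube _ ler01).
have mQQ : measurable (Q `*` Q) by exact: measurableX.
have iQ : (leb \x leb)%E.-integrable setT (fun z => (KF * KG)%:E * (\1_(Q `*` Q) z)%:E)%E.
  apply: integrableZl => //; apply/integrableP; split.
    by apply/measurable_EFinP; exact: measurable_indic.
  under eq_integral do rewrite gee0_abs ?lee_fin//.
  have -> : (\int[(leb \x leb)%E]_z (\1_(Q `*` Q) z)%:E = leb Q * leb Q)%E.
    by rewrite integral_indic// setIT; exact: product_measure1E.
  by rewrite !QE -EFinM ltry.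
apply: (le_integrable _ _ _ iQ) => //; first exact/measurable_EFinP.
move=> z _ /=; rewrite lee_fin ger0_norm// [leRHS]ger0_norm ?mulr_ge0// indicE.
case: (boolP (z \in Q `*` Q)) => hz.
  rewrite mulr1 (le_trans (ler_norm _))// /H !normrM ler_pM ?mulr_ge0//.
  rewrite (le_trans _ (hF z.1))// ler_piMl// ger0_norm ?bochner_riesz_symbol_ge0//.
  exact: bochner_riesz_symbol_le1.
rewrite mulr0 /H /bochner_riesz_symbol ifF ?mul0r//; apply/negbTE/negP => hs.
move/negP: hz; apply; rewrite inE.
have hc (w : Rd) : sqnorm w < 1 -> Q w.
  move=> hw i; rewrite in_itv/= -ler_norml -(@expr_le1 _ 2)// real_normK ?num_real//.
  exact: (le_trans (coord_le_sqnorm w i) (ltW hw)).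
have x0 := sqnorm_ge0 z.1; have e0 := sqnorm_ge0 z.2.
by split; apply: hc; lra.
Qed.

(** On the support of the symbol all coordinates of the two frequencies are at most 1 in modulus, so
    |x . (xi + eta)| <= 2 / 32. As 2 pi <= 8, the angle is at most 1/2 and the cosine at least 1/2,
    while the rest of the integrand is nonnegative. *)
Lemma Re_bilinear_bochner_riesz_ge x (L : R) :
  (forall i, `|x ord0 i| <= (32 * d%:R)^-1) ->
  (L%:E <= \int[(leb \x leb)%E]_z (bochner_riesz_symbol alpha z.1 z.2 * F z.1 * G z.2)%:E)%E ->
  L / 2 <= complex.Re (bilinear_bochner_riesz alpha f g x).
Proof.
move=> hx hL.
pose c (z : Rd * Rd) := cos (2 * pi * dot x (z.1 + z.2)).
have ReE z : complex.Re (cexpi (2 * pi * dot x (z.1 + z.2)) *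
    real_complex R (bochner_riesz_symbol alpha z.1 z.2) *
    fourier f z.1 * fourier g z.2) = c z * H z.
  by rewrite fF gG /= /H /c !(mulr0, mul0r, subr0, addr0, add0r); ring.
have mc : measurable_fun setT c.
  apply: (measurableT_comp (f := @cos R)).
    by apply: continuous_measurable_fun; exact: continuous_cos.
  apply: measurable_funM => //; apply: measurable_sum => i; apply: measurable_funM => //.
  under eq_fun do rewrite mxE.
  apply: measurable_funD.
    exact: measurableT_comp (measurable_rV_coordR i) measurable_fst.
  exact: measurableT_comp (measurable_rV_coordR i) measurable_snd.
have icH : (leb \x leb)%E.-integrable setT (EFin \o (fun z => c z * H z)).
  have := integrableM_le1 integrable_H mc (fun z => norm_cos_le1 _).
  by under eq_fun do rewrite mulrC.
have -> : complex.Re (bilinear_bochner_riesz alpha f g x) =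
    (\int[(leb \x leb)%E]_z (c z * H z))%R.
  by apply: eq_Rintegral => z _; exact: ReE.
have LH : L <= (\int[(leb \x leb)%E]_z H z)%R.
  rewrite -lee_fin /Rintegral fineK//.
  exact: (integrable_fin_num measurableT integrable_H).
have h2 : (2^-1 * \int[(leb \x leb)%E]_z H z <= \int[(leb \x leb)%E]_z (c z * H z))%R.
  rewrite -RintegralZl//.
  apply: le_Rintegral => //.
    by have := integrableZl measurableT 2^-1 integrable_H.
  move=> z _; rewrite /H /bochner_riesz_symbol; case: ifP => h; last by rewrite !mul0r !mulr0.
  have := H_ge0 z; rewrite /H /bochner_riesz_symbol h => Hz.
  rewrite ler_wpM2r//; apply: cos_ge_half.
  have x0 := sqnorm_ge0 z.1; have e0 := sqnorm_ge0 z.2.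
  have hc (w : Rd) i : sqnorm w < 1 -> `|w ord0 i| <= 1.
    move=> hw; rewrite -(@expr_le1 _ 2)// real_normK ?num_real//.
    exact: (le_trans (coord_le_sqnorm w i) (ltW hw)).
  have hd : `|dot x (z.1 + z.2)| <= 16^-1.
    rewrite /dot (le_trans (ler_norm_sum _ _ _))//.
    apply: (@le_trans _ _ (\sum_(i < d) (32 * d%:R)^-1 * 2)).
      apply: ler_sum => i _; rewrite normrM ler_pM//.
      rewrite mxE (le_trans (ler_normD _ _))// (_ : 2 = 1 + 1)// lerD// hc//; lra.
    rewrite sumr_const card_ord -[X in X <= _]mulr_natl.
    have [->|dn0] := eqVneq d 0%N; first by rewrite mulr0n mul0r.
    have d0 : 0 < d%:R :> R by rewrite ltr0n lt0n.
    rewrite le_eqVlt; apply/orP; left; apply/eqP; field; rewrite gt_eqF//.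
  rewrite !normrM [`|2|]ger0_norm// [`|pi|]ger0_norm ?pi_ge0//.
  have p4 : pi <= 4 :> R by have := @pihalf_lt2 R; lra.
  have p0 : 0 <= pi :> R := pi_ge0 R.
  move: hd p4 p0; generalize (pi : R) => P; set D := `|_| => hd p4 p0.
  have D0 : 0 <= D by exact: normr_ge0.
  nra.
by apply: le_trans h2; rewrite [leRHS]mulrC ler_wpM2r.
Qed.

End fourier_real.
End symbol.
End bilinear_lower_bound.

(** * Integrals over overlapping sets and volumes of sheared boxes *)

Section measure_lower_bounds.
Context {R : realType}.

(** The sets may overlap: it is the sum of their indicators that lies below h, so each of them
    counts in full. *)
Lemma sum_measure_le_integral dd (T : measurableType dd) (mu : {measure set T -> \bar R})
    (I : finType) (E : I -> set T) (h : T -> R) (v : R) :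
  (forall k, measurable (E k)) -> 0 <= v ->
  (forall z, \sum_k v * \1_(E k) z <= h z) ->
  (\sum_k v%:E * mu (E k) <= \int[mu]_z (h z)%:E)%E.
Proof.
move=> mE v0 hE.
have -> : (\sum_k v%:E * mu (E k) = \int[mu]_z (\sum_k v * \1_(E k) z)%:E)%E.
  under eq_integral do rewrite -sumEFin.
  rewrite ge0_integral_sum//; last 2 first.
  - move=> k; apply/measurable_EFinP; apply: measurable_funM => //; exact: measurable_indic.
  - by move=> k z _; rewrite lee_fin mulr_ge0.
  apply: eq_bigr => k _; under eq_integral do rewrite EFinM.
  rewrite ge0_integralZl//=; last by apply/measurable_EFinP; exact: measurable_indic.
  by rewrite integral_indic// setIT.
apply: ge0_le_integral_nomeas => z; rewrite lee_fin//.
by apply: sumr_ge0 => k _; rewrite mulr_ge0.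
Qed.

Local Notation leb := (@lebesgue_measure R).

(** The first coordinate is integrated innermost because a sheared box is an interval in it once the
    others are fixed. *)
Lemma ge0_integral_rVS_swap n (f : 'rV[R]_n.+1 -> \bar R) :
  measurable_fun setT f -> (forall x, (0 <= f x)%E) ->
  (\int[lebesgue_rV n.+1]_x f x =
   \int[lebesgue_rV n]_y \int[leb]_t f (rV_cons (t, y)))%E.
Proof.
move=> mf f0; rewrite ge0_integral_rVS//.
have mfc : measurable_fun setT (f \o @rV_cons R n).
  exact: measurableT_comp mf (@measurable_rV_cons R n).
exact: (fubini_tonelli (m1 := leb) (m2 := lebesgue_rV n) (f \o @rV_cons R n) mfc (fun z => f0 _)).
Qed.

Lemma itv_subl (c t lo hi : R) : (c - t \in `[lo, hi]) = (t \in `[c - hi, c - lo]).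
Proof. by rewrite !in_itv/=; apply/idP/idP => /andP[h1 h2]; apply/andP; split; lra. Qed.

(** The scalar product of (1, th) with D - xi, which is the linear form inside [packet_hat] at D -
    xi. *)
Definition slab n (th : 'rV[R]_n) (D xi : 'rV[R]_n.+1) : R :=
  (D ord0 ord0 - xi ord0 ord0) + dot th ((rV_uncons D).2 - (rV_uncons xi).2).

Definition sheared_box n (th : 'rV[R]_n) (D : 'rV[R]_n.+1) (h lo hi : R) :
    set 'rV[R]_n.+1 :=
  [set xi | (forall i, (rV_uncons xi).2 ord0 i \in
              `[(rV_uncons D).2 ord0 i - h, (rV_uncons D).2 ord0 i + h]) /\
            slab th D xi \in `[lo, hi]].

Lemma measurable_slab n (th : 'rV[R]_n) D : measurable_fun setT (slab th D).
Proof.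
apply: measurable_funD.
  by apply: measurable_funB => //; exact: measurable_rV_coordR.
apply: measurable_sum => i; apply: measurable_funM => //.
under eq_fun do rewrite !mxE.
by apply: measurable_funB => //; exact: measurable_rV_coordR.
Qed.

Lemma measurable_sheared_box n (th : 'rV[R]_n) D h lo hi :
  measurable (sheared_box th D h lo hi).
Proof.
have -> : sheared_box th D h lo hi =
    (\bigcap_(i in [set: 'I_n]) ((fun x : 'rV[R]_n.+1 => x ord0 (lift ord0 i)) @^-1`
      [set` `[(rV_uncons D).2 ord0 i - h, (rV_uncons D).2 ord0 i + h]])) `&`
    (slab th D @^-1` [set` `[lo, hi]]).
  apply/seteqP; split => x [h1 h2]; split => // i.
    by move=> _; have := h1 i; rewrite /= mxE.
  by have := h1 i I; rewrite /= [in X in _ -> X]mxE.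
apply: measurableI.
  apply: fin_bigcap_measurable => [|i _]; first exact: finite_finset.
  by rewrite -[X in measurable X]setTI; apply: measurable_rV_coordR => //; exact: measurable_itv.
by rewrite -[X in measurable X]setTI; apply: measurable_slab => //; exact: measurable_itv.
Qed.

(** A shear preserves volume: each slice in the first coordinate is a translate of an interval of
    length hi - lo. *)
Lemma lebesgue_sheared_box n (th : 'rV[R]_n) D h lo hi : 0 <= h -> lo <= hi ->
  lebesgue_rV n.+1 (sheared_box th D h lo hi) = ((hi - lo) * (2 * h) ^+ n)%:E.
Proof.
move=> h0 lohi; set X := sheared_box _ _ _ _ _.
have mX : measurable X by exact: measurable_sheared_box.
pose B : set 'rV[R]_n := [set y | forall i,
   y ord0 i \in `[(rV_uncons D).2 ord0 i - h, (rV_uncons D).2 ord0 i + h]].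
have mB : measurable B.
  have -> : B = \bigcap_(i in [set: 'I_n]) ((fun y : 'rV[R]_n => y ord0 i) @^-1`
      [set` `[(rV_uncons D).2 ord0 i - h, (rV_uncons D).2 ord0 i + h]]).
    by apply/seteqP; split => [x hx i _|x hx i]; [exact: hx|exact: (hx i I)].
  apply: fin_bigcap_measurable => [|i _]; first exact: finite_finset.
  by rewrite -[X in measurable X]setTI; apply: measurable_rV_coordR => //; exact: measurable_itv.
have BE : lebesgue_rV n B = ((2 * h) ^+ n)%:E.
  have -> : lebesgue_rV n B = _ := @lebesgue_rV_box R n (fun i =>
     [set` `[(rV_uncons D).2 ord0 i - h, (rV_uncons D).2 ord0 i + h]]) (fun i => measurable_itv _).
  have e i : lebesgue_measure [set` `[(rV_uncons D).2 ord0 i - h, (rV_uncons D).2 ord0 i + h]] =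
      (2 * h)%:E.
    rewrite lebesgue_measure_itv/= lte_fin; case: ifPn => [_|].
      by rewrite -EFinB; congr EFin; ring.
    by rewrite -leNgt => hh; congr EFin; lra.
  by under eq_bigr do rewrite e; rewrite prodEFin prodr_const card_ord.
have -> : lebesgue_rV n.+1 X = (\int[lebesgue_rV n.+1]_x (\1_X x)%:E)%E.
  by rewrite integral_indic// setIT.
rewrite ge0_integral_rVS_swap//; last by apply/measurable_EFinP; exact: measurable_indic.
transitivity (\int[lebesgue_rV n]_y ((hi - lo)%:E * (\1_B y)%:E))%E.
  apply: eq_integral => y _.
  pose c := D ord0 ord0 + dot th ((rV_uncons D).2 - y).
  pose J : set (measurableTypeR R) := [set` `[c - hi, c - lo]].
  have mJ : measurable J by exact: measurable_itv.
  transitivity (\int[leb]_t ((\1_B y)%:E * (\1_J t)%:E))%E.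
    apply: eq_integral => t _; rewrite -EFinM !indicE; congr EFin.
    rewrite -natrM mulnb; congr (_%:R); congr (nat_of_bool _).
    have sE : slab th D (rV_cons (t, y)) = c - t by rewrite /slab rV_consK rV_cons0 /c addrAC.
    by apply/idP/andP; rewrite !inE /X /sheared_box /mkset rV_consK sE itv_subl => -[].
  rewrite ge0_integralZl//=; last by apply/measurable_EFinP; exact: measurable_indic.
  have -> : (\int[leb]_t (\1_J t)%:E = leb J)%E.
    by rewrite integral_indic// setIT.
  rewrite /J lebesgue_measure_itv/= lte_fin muleC; congr (_ * _)%E.
  case: ifPn => [_|]; first by rewrite -EFinB; congr EFin; ring.
  by rewrite -leNgt => hh; congr EFin; lra.
rewrite ge0_integralZl//=; last 2 first.
- by apply/measurable_EFinP; exact: measurable_indic.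
- by rewrite lee_fin subr_ge0.
by rewrite integral_indic// setIT [X in (_ * X)%E]BE -EFinM.
Qed.

End measure_lower_bounds.

(** * The test functions *)

Section packet_train.
Context {R : realType}.
Implicit Types (a b s t : R).

(* For t > n the term j = 0 dominates all the others. *)
Lemma alternating_gauss_sum_ge n t : n.+1%:R <= t ->
  2^-1 * expR (- (pi * t ^+ 2)) <=
  \sum_(j < n.+1) (-1) ^+ j * ('C(n, j))%:R * expR (- (pi * (t + j%:R) ^+ 2)) :> R.
Proof.
move=> nt; have p2 : 2 <= pi :> R := pi_ge2 R.
have t1 : 1 <= t by apply: le_trans nt; rewrite ler1n.
rewrite big_ord_recl/= expr0 bin0 !mul1r addr0.
set E := expR (- (pi * t ^+ 2)).
have E0 : 0 < E by exact: expR_gt0.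
(* For j >= 1 the exponent grows by at least t >= n + 1, and e >= 2. The binomial coefficients add
   up to at most 2^n, so the whole tail is at most E / 2. *)
have tail (j : 'I_n) : expR (- (pi * (t + (bump 0 j)%:R) ^+ 2)) <= E * 2^-1 ^+ n.+1.
  apply: (@le_trans _ _ (E * expR (- n.+1%:R))).
    rewrite -expRD ler_expR -opprD lerN2 /bump leq0n add1n.
    have j1 : 1 <= j.+1%:R :> R by rewrite ler1n.
    apply: (@le_trans _ _ (pi * (t ^+ 2 + t))).
      rewrite mulrDr lerD2l (le_trans nt)// ler_peMl//; first by rewrite (le_trans _ t1).
      by rewrite (le_trans _ p2)// ler1n.
    rewrite ler_wpM2l//; first by rewrite (le_trans _ p2).
    nra.
  rewrite ler_pM2l// expRN exprVn lef_pV2 ?posrE ?expR_gt0 ?exprn_gt0//.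
  rewrite -[X in expR X]mulr1 expRM_natl lerXn2r ?nnegrE ?expR_ge0//.
  by have := @expR_ge1Dx R 1; lra.
have -> : 2^-1 * E = E - 2^-1 * E by field.
rewrite lerD2l -[X in - X]mulr1 lerNl.
have sum2 : \sum_(j < n) ('C(n, bump 0 j))%:R <= 2 ^+ n :> R.
  have : \sum_(i < n.+1) 'C(n, i)%:R = 2 ^+ n :> R.
    by have := @exprDn R 1 1 n; under eq_bigr do rewrite !expr1n mulr1 -mulr_natl mulr1.
  by rewrite big_ord_recl/= => <-; rewrite lerDr.
rewrite -sumrN; apply: (@le_trans _ _ (\sum_(j < n) ('C(n, bump 0 j))%:R * (E * 2^-1 ^+ n.+1))).
  apply: ler_sum => j _; rewrite -mulNr -mulrN1.
  apply: (@le_trans _ _ ('C(n, bump 0 j)%:R * expR (- (pi * (t + (bump 0 j)%:R) ^+ 2)))).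
    rewrite ler_wpM2r ?expR_ge0// mulrN1 (le_trans (ler_norm _))// normrN normrM normrX normrN1.
    by rewrite expr1n mul1r ger0_norm.
  by rewrite ler_wpM2l.
rewrite -mulr_suml (le_trans (ler_wpM2r _ sum2))//; first by rewrite mulr_ge0 ?exprn_ge0// ltW.
have p : 2 ^+ n * 2^-1 ^+ n = 1 :> R by rewrite -exprMn divff// expr1n.
have -> : 2 ^+ n * (E * 2^-1 ^+ n.+1) = 2^-1 * E * (2 ^+ n * 2^-1 ^+ n) by rewrite exprS; ring.
by rewrite p !mulr1.
Qed.

Section one_direction.
Variables (n : nat) (th : 'rV[R]_n).
Implicit Types (xi eta : 'rV[R]_n.+1).

Definition tau : R := (Num.sqrt (1 + sqnorm th))^-1.
Definition dir : 'rV[R]_n.+1 := tau *: rV_cons (1 : R, th).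

Let th1 : 0 < 1 + sqnorm th.
Proof. by rewrite ltr_wpDr// sqnorm_ge0. Qed.

Lemma tau_gt0 : 0 < tau.
Proof. by rewrite invr_gt0 sqrtr_gt0. Qed.

Lemma dot_dir xi : dot dir xi = tau * (xi ord0 ord0 + dot th (rV_uncons xi).2).
Proof.
rewrite /dir -[xi]rV_unconsK; case: (rV_uncons xi) => s z.
by rewrite dotZl dot_cons mul1r rV_consK rV_cons0.
Qed.

Lemma sqnorm_dir : sqnorm dir = 1.
Proof.
have e : dir ord0 ord0 + dot th (rV_uncons dir).2 = tau * (1 + sqnorm th).
  rewrite /dir mxE rV_cons0 mulr1 mulrDr mulr1; congr (_ + _).
  rewrite /dot mulr_sumr; apply: eq_bigr => i _.
  by rewrite /= !mxE liftK/=; ring.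
rewrite /sqnorm dot_dir e /tau mulrA -expr2 exprVn sqr_sqrtr ?ltW//.
by rewrite mulVf// gt_eqF.
Qed.

(** Up to the factor [tau], the slab coordinate is the signed distance to the tangent hyperplane of
    the unit sphere at [dir]. *)
Lemma tau_slab xi : tau * slab th dir xi = 1 - dot dir xi.
Proof.
have <- : dot dir dir = 1 := sqnorm_dir.
rewrite !dot_dir /slab -mulrBr; congr (_ * _).
have -> : dot th ((rV_uncons dir).2 - (rV_uncons xi).2) =
    dot th (rV_uncons dir).2 - dot th (rV_uncons xi).2 by exact: dotBr.
ring.
Qed.

Lemma slab_dir_ge0 xi : sqnorm xi <= 1 -> 0 <= slab th dir xi.
Proof.
move=> h; rewrite -(pmulr_rge0 _ tau_gt0) tau_slab subr_ge0.
have : 2 * dot dir xi <= sqnorm dir + sqnorm xi.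
  rewrite /dot /sqnorm /dot mulr_sumr -big_split/=; apply: ler_sum => i _.
  by have := sqr_ge0 (dir ord0 i - xi ord0 i); nra.
rewrite sqnorm_dir; lra.
Qed.

(** A shift along the first axis, unlike one along the normal, leaves the transverse coordinates
    alone; shifted copies of a packet thus differ only in a one-dimensional Gaussian. *)
Lemma packet_hat_shift a b D s xi :
  packet_hat a b th (D + rV_cons (s : R, 0) - xi) =
  Num.sqrt a^-1 * Num.sqrt b^-1 ^+ n * expR (- (pi * (slab th D xi + s) ^+ 2 / a)) *
  expR (- (pi * sqnorm ((rV_uncons D).2 - (rV_uncons xi).2) / b)).
Proof.
have e2 : (rV_uncons (D + rV_cons (s : R, 0) - xi)).2 = (rV_uncons D).2 - (rV_uncons xi).2.
  by apply/rowP => i; rewrite /= !mxE liftK/= mxE addr0.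
have e1 : (D + rV_cons (s : R, 0) - xi) ord0 ord0 = D ord0 ord0 + s - xi ord0 ord0.
  by rewrite !mxE unlift_none.
have e3 : D ord0 ord0 + s - xi ord0 ord0 + dot th ((rV_uncons D).2 - (rV_uncons xi).2) =
    slab th D xi + s by rewrite /slab; ring.
by rewrite /packet_hat e1 e2 e3.
Qed.

End one_direction.

Lemma sqnorm_le_coord n (x : 'rV[R]_n) (h : R) : 0 <= h ->
  (forall i, `|x ord0 i| <= h) -> sqnorm x <= n%:R * h ^+ 2.
Proof.
move=> h0 hx; rewrite /sqnorm /dot; apply: (@le_trans _ _ (\sum_(i < n) h ^+ 2)).
  apply: ler_sum => i _; rewrite -expr2 -real_normK ?num_real//.
  by rewrite lerXn2r ?nnegrE.
by rewrite sumr_const card_ord -[X in X <= _]mulr_natl.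
Qed.

Lemma sqnorm_uncons n (x : 'rV[R]_n.+1) :
  sqnorm x = x ord0 ord0 ^+ 2 + sqnorm (rV_uncons x).2.
Proof.
by rewrite -[x]rV_unconsK; case: (rV_uncons x) => s z; rewrite rV_consK rV_cons0 sqnorm_cons.
Qed.

End packet_train.

(** * Size and Fourier transform of the packet train and of the Gaussian bell *)

Section test_functions.
Context {R : realType}.
Variables (n M : nat).
Hypotheses (n0 : (0 < n)%N) (M0 : (0 < M)%N).
Local Notation Rd := 'rV[R]_n.+1.
Local Notation dl := (@delta R M).
Implicit Types (x y xi eta : Rd).

Lemma delta_gt0 : 0 < dl.
Proof. by rewrite exprn_gt0// invr_gt0 ltr0n. Qed.

Lemma sqrt_deltaV : Num.sqrt dl^-1 = M%:R.
Proof. by rewrite /delta exprVn invrK sqrtr_sqr ger0_norm. Qed.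

Lemma sqrt_delta2V : Num.sqrt (dl ^+ 2)^-1 = M%:R ^+ 2.
Proof. by rewrite /delta !exprVn invrK sqrtr_sqr ger0_norm ?exprn_ge0. Qed.

Definition direction (k : {ffun 'I_n -> 'I_M}) : Rd := dir (slope k).

(* The coefficients expand the factor (1 - e^(2 pi i delta y_0))^n of [trainE],
   which vanishes to order n at y_0 = 0, where all the tubes overlap.  The
   frequencies lie outside the unit ball at distance at least about n delta,
   which makes [train_hat] positive on the ball. *)
Definition train_coef (p : {ffun 'I_n -> 'I_M} * 'I_n.+1) : R :=
  (-1) ^+ p.2 * ('C(n, p.2))%:R.

Definition train_freq (p : {ffun 'I_n -> 'I_M} * 'I_n.+1) : Rd :=
  direction p.1 + rV_cons (dl * (n.+1%:R + p.2%:R), 0).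

Definition train : Rd -> R[i] :=
  comb (dl ^+ 2) dl train_coef (fun p => slope p.1) train_freq.

Definition train_hat : Rd -> R :=
  comb_hat (dl ^+ 2) dl train_coef (fun p => slope p.1) train_freq.

(** The Gaussian exp (- pi delta |y|^2), written as a combination with a single packet of slope and
    frequency 0 so that the results on [comb] apply to it. *)
Definition bell : Rd -> R[i] :=
  comb dl dl (fun _ : unit => 1) (fun=> 0) (fun=> 0).

Definition bell_hat : Rd -> R :=
  comb_hat dl dl (fun _ : unit => 1) (fun=> 0) (fun=> 0).

Lemma normc_cexpi (t : R) : ComplexField.Normc.normc (cexpi t) = 1.
Proof. by rewrite /cexpi /= cos2Dsin2 sqrtr1. Qed.

Lemma normc_real (t : R) : ComplexField.Normc.normc (real_complex R t) = `|t|.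
Proof. by rewrite /= expr0n/= addr0 sqrtr_sqr. Qed.

Lemma normc_sum_le (I : Type) (r : seq I) (f : I -> R[i]) :
  ComplexField.Normc.normc (\sum_(i <- r) f i) <=
  \sum_(i <- r) ComplexField.Normc.normc (f i).
Proof.
elim: r => [|i r IH]; first by rewrite !big_nil ComplexField.Normc.normc0.
by rewrite !big_cons (le_trans (le_normcD _ _))// lerD2l.
Qed.

Lemma normcX (z : R[i]) m :
  ComplexField.Normc.normc (z ^+ m) = ComplexField.Normc.normc z ^+ m.
Proof.
elim: m => [|m IH]; first by rewrite !expr0 ComplexField.Normc.normc1.
by rewrite !exprS ComplexField.Normc.normcM IH.
Qed.

Lemma cexpiMn (t : R) m : cexpi (t * m%:R) = cexpi t ^+ m.
Proof.
elim: m => [|m IH]; first by rewrite mulr0 expr0 /cexpi cos0 sin0.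
by rewrite -natr1 mulrDr mulr1 cexpiD IH exprSr.
Qed.

(** The factors 1 fit the form of [Lpnorm_gauss_le] with C = k = 1. *)
Lemma normc_bell y :
  ComplexField.Normc.normc (bell y) <= 1 * expR (- (pi * (1 * dl) * sqnorm y)).
Proof.
rewrite /bell combE (big_pred1 tt)//.
rewrite ComplexField.Normc.normcM normc_cexpi normc_real !mul1r mulr1.
rewrite ger0_norm ?packet_ge0// /packet scaler0 /gauss1 /gauss -expRD !subr0 sqnorm_uncons.
by rewrite ler_expR le_eqVlt; apply/orP; left; apply/eqP; generalize (pi : R) => P; ring.
Qed.

(** Summing over the shifts j is the binomial theorem; the common outward shift (n + 1) delta
    contributes only the unimodular factor in front. *)
Lemma trainE y : train y =
  cexpi (2 * pi * (dl * n.+1%:R * y ord0 ord0)) * (1 - cexpi (2 * pi * (dl * y ord0 ord0))) ^+ n *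
  \sum_(k : {ffun 'I_n -> 'I_M}) real_complex R (packet (dl ^+ 2) dl (slope k) y) *
     cexpi (2 * pi * dot y (direction k)).
Proof.
rewrite /train combE [RHS]mulr_sumr.
rewrite (eq_bigr (fun p => real_complex R (train_coef (p.1, p.2) * packet (dl ^+ 2) dl (slope p.1) y) *
   cexpi (2 * pi * dot y (train_freq (p.1, p.2))))); last by case.
rewrite -(pair_bigA _ (fun k j => real_complex R (train_coef (k, j) * packet (dl ^+ 2) dl (slope k) y) *
   cexpi (2 * pi * dot y (train_freq (k, j)))))/=.
apply: eq_bigr => k _; rewrite exprBn mulr_sumr mulr_suml; apply: eq_bigr => j _.
rewrite /train_freq /=.
have -> : dot y (direction k + rV_cons (dl * (n.+1%:R + j%:R), 0)) =
    dot y (direction k) + dl * n.+1%:R * y ord0 ord0 + dl * y ord0 ord0 * j%:R.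
  have -> : dot y (direction k + rV_cons (dl * (n.+1%:R + j%:R), 0)) =
    dot y (direction k) + dot y (rV_cons (dl * (n.+1%:R + j%:R), 0)).
    by rewrite /dot -big_split/=; apply: eq_bigr => i _; rewrite mxE mulrDr.
  rewrite -[y in dot y (rV_cons _)]rV_unconsK; case E : (rV_uncons y) => [y0 z].
  have y0E : y ord0 ord0 = y0 by case: E.
  rewrite dot_cons [dot z 0]big1 ?addr0 ?y0E; last by move=> i _; rewrite mxE mulr0.
  ring.
set A := dot y (direction k); set B := dl * n.+1%:R * y ord0 ord0; set D := dl * y ord0 ord0.
have -> : 2 * pi * (A + B + D * j%:R) = 2 * pi * A + 2 * pi * B + 2 * pi * D * j%:R.
  by generalize (pi : R) => P; ring.
rewrite !cexpiD cexpiMn.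
rewrite /train_coef rmorphM/= rmorphM/= rmorphXn rmorphN1 rmorph_nat expr1n mulr1 -mulr_natr.
ring.
Qed.

(** The zero of order n at y_0 = 0 supplies the power of the minimum that [packet_sum_le] consumes;
    the resulting constant does not depend on M. *)
Lemma normc_train y : ComplexField.Normc.normc (train y) <=
  ((2 * pi) ^+ n * (3 * pi) ^+ n) * expR (- (pi * ((4 * n%:R)^-1 * dl ^+ 2) * sqnorm y)).
Proof.
rewrite trainE !ComplexField.Normc.normcM normc_cexpi mul1r normcX -[leRHS]mulrA.
set m := Num.min 1 `|dl * y ord0 ord0|.
have m0 : 0 <= m by rewrite le_min ler01 normr_ge0.
have p1 : 1 <= pi :> R by rewrite (le_trans _ (pi_ge2 R))// ler1n.
have p0 : 0 <= pi :> R := pi_ge0 R.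
have h1 : ComplexField.Normc.normc (1 - cexpi (2 * pi * (dl * y ord0 ord0))) <= 2 * pi * m.
  apply: (le_trans (normc_1Bcexpi _)).
  rewrite normrM [`|2 * pi|]ger0_norm ?mulr_ge0//.
  rewrite /m minr_pMr ?mulr_ge0// mulr1 le_min !ge_min lexx orbT andbT.
  by rewrite ler_peMr.
apply: (@le_trans _ _ ((2 * pi * m) ^+ n *
    \sum_(k : {ffun 'I_n -> 'I_M}) packet (dl ^+ 2) dl (slope k) y)).
  apply: ler_pM; rewrite ?exprn_ge0 ?normc_ge0//.
    by rewrite lerXn2r ?nnegrE ?normc_ge0// !mulr_ge0.
  apply: (le_trans (normc_sum_le _ _)); apply: ler_sum => k _.
  by rewrite ComplexField.Normc.normcM normc_cexpi normc_real mulr1 ger0_norm ?packet_ge0.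
rewrite exprMn -[leLHS]mulrA ler_wpM2l ?exprn_ge0 ?mulr_ge0//.
exact: packet_sum_le.
Qed.

Lemma schwartz_train : schwartz train.
Proof. by apply: schwartz_comb; [exact: exprn_gt0 delta_gt0|exact: delta_gt0]. Qed.

Lemma schwartz_bell : schwartz bell.
Proof. by apply: schwartz_comb; exact: delta_gt0. Qed.

Lemma fourier_train xi : fourier train xi = real_complex R (train_hat xi).
Proof. by apply: fourier_comb; [exact: exprn_gt0 delta_gt0|exact: delta_gt0]. Qed.

Lemma fourier_bell xi : fourier bell xi = real_complex R (bell_hat xi).
Proof. by apply: fourier_comb; exact: delta_gt0. Qed.

Lemma bell_hat_ge0 xi : 0 <= bell_hat xi.
Proof.
apply: sumr_ge0 => i _; rewrite mul1r /packet_hat.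
by apply: mulr_ge0; [apply: mulr_ge0; [exact: mulr_ge0|exact: expR_ge0]|exact: expR_ge0].
Qed.

(** For each slope the sum over the shifts is the alternating sum at t = s / delta + n + 1, and s >=
    0 on the unit ball gives t >= n + 1. The amplitude M^(n+2) is (delta^2)^(-1/2) delta^(-n/2). *)
Lemma train_hat_ge xi : sqnorm xi <= 1 ->
  \sum_(k : {ffun 'I_n -> 'I_M}) 2^-1 * M%:R ^+ n.+2 *
    expR (- (pi * (slab (slope k) (direction k) xi / dl + n.+1%:R) ^+ 2)) *
    expR (- (pi * sqnorm ((rV_uncons (direction k)).2 - (rV_uncons xi).2) / dl))
  <= train_hat xi.
Proof.
move=> xi1; rewrite /train_hat /comb_hat.
rewrite (eq_bigr (fun p => train_coef (p.1, p.2) *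
  packet_hat (dl ^+ 2) dl (slope p.1) (train_freq (p.1, p.2) - xi))); last by case.
rewrite -(pair_bigA _ (fun k j => train_coef (k, j) *
  packet_hat (dl ^+ 2) dl (slope k) (train_freq (k, j) - xi)))/=.
apply: ler_sum => k _; have dl0 := delta_gt0.
set s := slab _ _ _; set g := expR (- (pi * sqnorm _ / dl)).
have s0 : 0 <= s / dl by rewrite divr_ge0 ?slab_dir_ge0// ltW.
under eq_bigr => j _.
  rewrite /train_freq packet_hat_shift sqrt_deltaV sqrt_delta2V -exprD add2n -/g -/s.
  rewrite (_ : pi * (s + dl * (n.+1%:R + j%:R)) ^+ 2 / dl ^+ 2 =
     pi * ((s / dl + n.+1%:R) + j%:R) ^+ 2); last first.
    by move: dl0; generalize dl (pi : R) => D P D0; field; rewrite gt_eqF.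
  rewrite /train_coef /=.
  rewrite (_ : _ * (_ * _) = (M%:R ^+ n.+2 * g) * ((-1) ^+ j * 'C(n, j)%:R *
      expR (- (pi * (s / dl + n.+1%:R + j%:R) ^+ 2)))); last by ring.
  over.
rewrite -mulr_sumr.
have -> : 2^-1 * M%:R ^+ n.+2 * expR (- (pi * (s / dl + n.+1%:R) ^+ 2)) * g =
  (M%:R ^+ n.+2 * g) * (2^-1 * expR (- (pi * (s / dl + n.+1%:R) ^+ 2))) by ring.
rewrite ler_wpM2l//; first by rewrite (mulr_ge0 (exprn_ge0 n.+2 (ler0n R M)))// expR_ge0.
by apply: alternating_gauss_sum_ge; rewrite lerDr.
Qed.

End test_functions.

(** * The quantitative lower bound *)

Section lower_bound.
Context {R : realType}.

Lemma sqnormB m (x y : 'rV[R]_m) : sqnorm (x - y) = sqnorm x - 2 * dot x y + sqnorm y.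
Proof.
rewrite /sqnorm /dot mulr_sumr -sumrB -big_split/=; apply: eq_bigr => i _.
by rewrite !mxE; ring.
Qed.

Variables (n M : nat).
(** Amounts to 2 delta <= h for the half-side h of the caps below. *)
Hypothesis M0 : (4 * n.+1 ^ 2 <= M)%N.
Local Notation Rd := 'rV[R]_n.+1.
Local Notation dl := (@delta R M).
Local Notation d := (n.+1%:R : R).
Implicit Types (x y xi eta : Rd).

(* Constant chosen so that [cap k] times [bell_core] stays at distance comparable
   to delta inside the unit ball of R^2d. *)
Definition box_const : R := (2 * d ^+ 2)^-1.
Local Notation h := (box_const / M%:R).

Let Mgt0 : (0 < M)%N.
Proof. by apply: leq_trans M0; rewrite muln_gt0 expn_gt0. Qed.

Let MR : 0 < M%:R :> R. Proof. by rewrite ltr0n. Qed.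

Let d1 : 1 <= d. Proof. by rewrite ler1n. Qed.

Let dl0 : 0 < dl := @delta_gt0 R M Mgt0.

Let c0 : 0 < box_const.
Proof. by rewrite invr_gt0 mulr_gt0// exprn_gt0. Qed.

Let h0 : 0 < h. Proof. exact: divr_gt0. Qed.

Let h2E : h ^+ 2 = box_const ^+ 2 * dl.
Proof. by rewrite exprMn. Qed.

Let c1 : box_const <= 1.
Proof.
rewrite invf_le1 ?mulr_gt0 ?exprn_gt0//.
have : 1 <= d ^+ 2 by rewrite exprn_ege1.
by move: (d ^+ 2) => D; lra.
Qed.

Let h2dl : h ^+ 2 <= dl.
Proof.
by rewrite h2E ler_piMl//; [exact: ltW|apply: exprn_ile1 => //; exact: ltW].
Qed.

Let dl2h : 2 * dl <= h.
Proof.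
have M4 : 4 * d ^+ 2 <= M%:R by rewrite -natrX -natrM ler_nat.
have -> : 2 * dl = 2 / M%:R / M%:R by rewrite /delta; field; rewrite gt_eqF.
rewrite ler_pM2r ?invr_gt0// ler_pdivrMr//.
apply: le_trans (ler_wpM2l (ltW c0) M4).
have -> : box_const * (4 * d ^+ 2) = 2; last exact: lexx.
by rewrite /box_const; field; rewrite gt_eqF// ltr0n.
Qed.

(** The slab coordinate is at least delta, which keeps the cap inside the sphere, and at most 2
    delta, where its Gaussian has lost only a constant factor. *)
Definition cap (k : {ffun 'I_n -> 'I_M}) : set Rd :=
  sheared_box (slope k) (direction k) h dl (2 * dl).

Definition bell_core : set Rd := [set x : Rd | forall i, x ord0 i \in `[- h, h]].

(** Values at the worst point of a cap: the normal Gaussian is evaluated at no more than 2 + (n +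
    1), and the transverse square norm is at most n h^2 <= n delta. *)
Definition train_level : R :=
  2^-1 * M%:R ^+ n.+2 * (expR (- (pi * (n + 3)%:R ^+ 2)) * expR (- (pi * n%:R))).

Definition bell_level : R := M%:R ^+ n.+1 * expR (- (pi * d)).

Let box_sqnorm xi k : cap k xi ->
  sqnorm ((rV_uncons (direction k)).2 - (rV_uncons xi).2) <= n%:R * h ^+ 2.
Proof.
move=> [hx _]; apply: sqnorm_le_coord; first exact: ltW.
move=> i; have := hx i; rewrite in_itv/= => /andP[ha hb].
have -> : ((rV_uncons (direction k)).2 - (rV_uncons xi).2) ord0 i =
  (rV_uncons (direction k)).2 ord0 i - (rV_uncons xi).2 ord0 i by rewrite [LHS]mxE [X in _ + X]mxE.
move: ha hb; move: ((rV_uncons (direction k)).2 ord0 i) ((rV_uncons xi).2 ord0 i) => u w ha hb.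
by rewrite ler_norml; apply/andP; split; lra.
Qed.

Lemma train_hat_ge_cap xi : sqnorm xi <= 1 ->
  \sum_k train_level * \1_(cap k) xi <= train_hat M xi :> R.
Proof.
move=> xi1; apply: (le_trans _ (train_hat_ge Mgt0 xi1)); apply: ler_sum => k _.
have nn (u w : R) : 0 <= 2^-1 * M%:R ^+ n.+2 * expR u * expR w.
  by rewrite mulr_ge0 ?expR_ge0// mulr_ge0 ?expR_ge0// mulr_ge0// (exprn_ge0 n.+2 (ltW MR)).
rewrite indicE; case: (boolP (xi \in cap k)) => [|_]; last by rewrite mulr0; exact: nn.
rewrite inE => hk; have [_] := hk; rewrite in_itv/= => /andP[s1 s2].
rewrite mulr1 /train_level [leLHS]mulrA.
set s := slab _ _ _ in s1 s2 *.
have sd1 : 1 <= s / dl by rewrite ler_pdivlMr// mul1r.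
have sd2 : s / dl <= 2 by rewrite ler_pdivrMr.
have A0 : 0 <= 2^-1 * M%:R ^+ n.+2 :> R.
  by rewrite mulr_ge0// (exprn_ge0 n.+2 (ltW MR)).
have e1 : expR (- (pi * (n + 3)%:R ^+ 2)) <= expR (- (pi * (s / dl + n.+1%:R) ^+ 2)) :> R.
  rewrite ler_expR lerN2 ler_wpM2l ?pi_ge0//.
  have -> : (n + 3)%:R = 2 + n.+1%:R :> R by rewrite -natrD add2n addn3.
  by rewrite lerXn2r ?nnegrE ?lerD2r ?addr_ge0// (le_trans _ sd1).
apply: ler_pM; first by rewrite mulr_ge0// expR_ge0.
- exact: expR_ge0.
- by rewrite ler_wpM2l.
rewrite ler_expR lerN2 -mulrA ler_wpM2l ?pi_ge0// ler_pdivrMr//.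
apply: (le_trans (box_sqnorm hk)).
by rewrite ler_wpM2l.
Qed.

Lemma train_hat_ge0 xi : sqnorm xi <= 1 -> 0 <= train_hat M xi :> R.
Proof.
move=> xi1; apply: le_trans (train_hat_ge_cap xi1); apply: sumr_ge0 => k _.
apply: mulr_ge0 => //; apply: mulr_ge0; last by rewrite mulr_ge0 ?expR_ge0.
by rewrite mulr_ge0// (exprn_ge0 n.+2 (ltW MR)).
Qed.

Let core_sqnorm eta : bell_core eta -> sqnorm eta <= d * h ^+ 2.
Proof.
move=> he; apply: sqnorm_le_coord; first exact: ltW.
by move=> i; have := he i; rewrite in_itv/= -ler_norml.
Qed.

Lemma bell_hat_ge_core eta : bell_core eta -> bell_level <= bell_hat M eta.
Proof.
move=> he; rewrite /bell_hat /comb_hat (big_pred1 tt)// mul1r /packet_hat !sqrt_deltaV//.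
have -> : dot 0 (rV_uncons (0 - eta)).2 = 0 :> R.
  by rewrite /dot big1// => i _; rewrite mxE mul0r.
rewrite addr0 -exprS -mulrA -expRD -opprD ler_wpM2l ?(exprn_ge0 n.+1 (ltW MR))//.
rewrite ler_expR lerN2 (_ : _ + _ = pi * (sqnorm (0 - eta) / dl)); last first.
  rewrite sqnorm_uncons; move: (sqnorm _) => u; generalize (pi : R) => P.
  by field; rewrite gt_eqF.
rewrite ler_wpM2l ?pi_ge0// ler_pdivrMr//.
have -> : sqnorm (0 - eta) = sqnorm eta.
  by rewrite /sqnorm /dot; apply: eq_bigr => i _; rewrite !mxE sub0r mulrNN.
by apply: (le_trans (core_sqnorm he)); rewrite ler_wpM2l.
Qed.

(** With D the direction, |xi|^2 = 1 - 2 tau s + |D - xi|^2. Here tau s >= delta / d, while |D -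
    xi|^2 + |eta|^2 <= (d^2 + 2 d) h^2 <= delta / d by the choice of [box_const], so half of the
    gained depth survives. *)
Lemma sqnorm_cap_core k xi eta : cap k xi -> bell_core eta ->
  sqnorm xi + sqnorm eta <= 1 - dl / d.
Proof.
move=> hk he; have hz := box_sqnorm hk; have := hk => -[hx].
rewrite in_itv/= => /andP[s1 s2]; set s := slab _ _ _ in s1 s2.
have th01 i : 0 <= (slope k : 'rV[R]_n) ord0 i <= 1.
  rewrite mxE divr_ge0//= ler_pdivrMr// mul1r ler_nat ltnW//.
(* Slopes have coordinates in [0, 1], so 1 + |theta|^2 <= n + 1 <= d^2. *)
have tauge : d^-1 <= tau (slope k).
  rewrite /tau lef_pV2 ?posrE ?sqrtr_gt0 ?ltr_wpDr ?sqnorm_ge0 ?ltr0n//.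
  rewrite -[leRHS]ger0_norm// -sqrtr_sqr ler_wsqrtr//.
  have : sqnorm (slope k) <= n%:R * 1 ^+ 2 :> R.
    by apply: sqnorm_le_coord => // i; have /andP[ta tb] := th01 i; rewrite ger0_norm.
  by rewrite expr1n mulr1 -natr1; move: (ler0n R n); nra.
have xiE : sqnorm xi = sqnorm (direction k - xi) + 1 - 2 * (tau (slope k) * s).
  by rewrite /s tau_slab sqnormB sqnorm_dir -/(direction k); ring.
have x0 : `|(direction k - xi) ord0 ord0| <= d * h.
  have e : (direction k - xi) ord0 ord0 =
      s - dot (slope k) ((rV_uncons (direction k)).2 - (rV_uncons xi).2).
    have -> : (direction k - xi) ord0 ord0 = direction k ord0 ord0 - xi ord0 ord0.
      by rewrite [LHS]mxE [X in _ + X]mxE.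
    by rewrite /s /slab; ring.
  rewrite e (le_trans (ler_normB _ _))//.
  have hs : `|s| <= h.
    by rewrite ger0_norm ?(le_trans s2)// (le_trans _ s1)// ltW.
  have hdot : `|dot (slope k) ((rV_uncons (direction k)).2 - (rV_uncons xi).2)| <= n%:R * h.
    rewrite /dot (le_trans (ler_norm_sum _ _ _))//.
    apply: (@le_trans _ _ (\sum_(i < n) h)); last first.
      by rewrite sumr_const card_ord -[X in X <= _]mulr_natl.
    apply: ler_sum => i _; have /andP[ta tb] := th01 i.
    rewrite normrM -[leRHS]mul1r; apply: ler_pM => //; first by rewrite ger0_norm.
    have := hx i; rewrite in_itv/= => /andP[ha hb].
    have -> : ((rV_uncons (direction k)).2 - (rV_uncons xi).2) ord0 i =
      (rV_uncons (direction k)).2 ord0 i - (rV_uncons xi).2 ord0 i by rewrite [LHS]mxE [X in _ + X]mxE.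
    move: ha hb; move: ((rV_uncons (direction k)).2 ord0 i) ((rV_uncons xi).2 ord0 i) => u w ha hb.
    by rewrite ler_norml; apply/andP; split; lra.
  by rewrite -natr1; lra.
have z2 : sqnorm (direction k - xi) <= (d * h) ^+ 2 + n%:R * h ^+ 2.
  rewrite sqnorm_uncons; apply: lerD.
    by rewrite -real_normK ?num_real// lerXn2r ?nnegrE// mulr_ge0// ltW.
  have -> : (rV_uncons (direction k - xi)).2 = (rV_uncons (direction k)).2 - (rV_uncons xi).2.
    by apply/rowP => i; rewrite !mxE.
  exact: hz.
have he2 := core_sqnorm he.
have ts : dl / d <= tau (slope k) * s.
  by rewrite mulrC ler_pM// ?invr_ge0 ?ltW.
have hh : (d ^+ 2 + 2 * d) * h ^+ 2 <= dl / d.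
  rewrite h2E mulrA mulrC ler_wpM2l//; first exact: ltW.
  rewrite /box_const.
  have dd : 0 < d by rewrite (lt_le_trans _ d1).
  rewrite exprVn ler_pdivrMr ?exprn_gt0 ?mulr_gt0 ?exprn_gt0//.
  have -> : d^-1 * (2 * d ^+ 2) ^+ 2 = 4 * d ^+ 3 by field; rewrite gt_eqF.
  have d2 : 1 <= d ^+ 2 by rewrite exprn_ege1.
  have : d <= d ^+ 3 by rewrite exprS ler_peMr// ltW.
  have : d ^+ 2 <= d ^+ 3 by rewrite [leRHS]exprS ler_peMl// exprn_ge0// ltW.
  lra.
have nd : n%:R = d - 1 by rewrite -natr1 addrK.
have h2p : 0 <= h ^+ 2 by rewrite sqr_ge0.
rewrite xiE; move: z2 he2 ts hh h2p; rewrite nd exprMn.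
move: (sqnorm (direction k - xi)) (sqnorm eta) (tau (slope k) * s) (dl / d) (h ^+ 2).
by generalize d => D S E T q H; nra.
Qed.

Variable alpha : R.
Hypothesis alpha0 : 0 <= alpha.

Let level : R := (dl / d) `^ alpha * train_level * bell_level.

Let train_level_ge0 : 0 <= train_level.
Proof.
apply: mulr_ge0; last by rewrite mulr_ge0 ?expR_ge0.
by rewrite mulr_ge0// (exprn_ge0 n.+2 (ltW MR)).
Qed.

Let bell_level_ge0 : 0 <= bell_level.
Proof. by rewrite mulr_ge0 ?expR_ge0// (exprn_ge0 n.+1 (ltW MR)). Qed.

Let level_ge0 : 0 <= level.
Proof. by apply: mulr_ge0 => //; rewrite mulr_ge0 ?powR_ge0. Qed.

(** One cap containing xi is enough to bound the symbol; [train_hat_ge_cap] then accounts for all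
    caps containing xi at once. If there is none, or eta is outside the core, the left side is 0 and
    the right side nonnegative, because the symbol vanishes off the unit ball. *)
Lemma symbol_train_bell_ge xi eta :
  \sum_k level * (\1_(cap k) xi * \1_bell_core eta) <=
  bochner_riesz_symbol alpha xi eta * train_hat M xi * bell_hat M eta.
Proof.
case: (pselect (exists2 k, cap k xi & bell_core eta)) => [[k hk he]|hN]; last first.
  rewrite big1; last first.
    move=> k _; rewrite !indicE.
    case: (boolP (xi \in cap k)) => [|_]; last by rewrite mul0r mulr0.
    rewrite inE => hk; case: (boolP (eta \in bell_core)) => [|_]; last by rewrite !mulr0.
    by rewrite inE => he; exfalso; apply: hN; exists k.
  rewrite /bochner_riesz_symbol; case: ifP => hs; last by rewrite !mul0r.
  rewrite mulr_ge0 ?bell_hat_ge0// mulr_ge0 ?powR_ge0// train_hat_ge0//.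
  by have := sqnorm_ge0 eta; lra.
have hs := sqnorm_cap_core hk he.
have xi1 : sqnorm xi <= 1.
  have := sqnorm_ge0 eta; have : 0 <= dl / d by rewrite divr_ge0// ltW.
  by move: hs; move: (dl / d) (sqnorm xi) (sqnorm eta) => u v w; lra.
have -> : \1_bell_core eta = 1 :> R by rewrite indicE mem_set.
rewrite (eq_bigr (fun k => (dl / d) `^ alpha * bell_level * (train_level * \1_(cap k) xi))); last first.
  by move=> k' _; rewrite /level; ring.
rewrite -mulr_sumr mulrAC; apply: ler_pM => //.
- apply: mulr_ge0; first exact: powR_ge0.
  by apply: sumr_ge0 => k' _; exact: mulr_ge0.
- apply: ler_pM; [exact: powR_ge0| | |exact: train_hat_ge_cap].
    by apply: sumr_ge0 => k' _; exact: mulr_ge0.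
  by apply: bochner_riesz_symbol_ge => //; rewrite divr_gt0// ltr0n.
- exact: bell_hat_ge_core.
Qed.

Definition gain : R := M%:R ^+ n * (level * (dl * (2 * h) ^+ n * (2 * h) ^+ n.+1)).

Let measurable_cap k : measurable (cap k).
Proof. exact: measurable_sheared_box. Qed.

Let measurable_core : measurable bell_core.
Proof. exact: measurable_cube. Qed.

Let lebesgue_cap k : lebesgue_rV n.+1 (cap k) = (dl * (2 * h) ^+ n)%:E.
Proof.
rewrite lebesgue_sheared_box ?(ltW h0)//; first by congr (_ * _)%:E; ring.
by have := dl0; generalize dl => D; lra.
Qed.

Let lebesgue_core : lebesgue_rV n.+1 bell_core = ((2 * h) ^+ n.+1)%:E.
Proof. exact: lebesgue_rV_cube (ltW h0). Qed.

Let indic_setX (A B : set Rd) z : \1_(A `*` B) z = \1_A z.1 * \1_B z.2 :> R.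
Proof. by rewrite !indicE in_setX -natrM mulnb. Qed.

Let sum_gain (E : {ffun 'I_n -> 'I_M} -> set (Rd * Rd)) :
  (forall k, (lebesgue_rV n.+1 \x lebesgue_rV n.+1)%E (E k) =
     (dl * (2 * h) ^+ n * (2 * h) ^+ n.+1)%:E) ->
  (\sum_k level%:E * (lebesgue_rV n.+1 \x lebesgue_rV n.+1) (E k))%E = gain%:E.
Proof.
move=> hE; under eq_bigr do rewrite hE -EFinM.
rewrite sumEFin sumr_const card_ffun !card_ord; congr EFin.
by rewrite /gain -natrX [RHS]mulr_natl.
Qed.

Let delta2_gt0 : 0 < dl ^+ 2. Proof. exact: exprn_gt0. Qed.

Lemma Re_train_bell_ge x : (forall i, `|x ord0 i| <= (32 * d)^-1) ->
  gain / 2 <= complex.Re (bilinear_bochner_riesz alpha (train M) (bell M) x).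
Proof.
move=> hx; apply: (Re_bilinear_bochner_riesz_ge alpha0 (fourier_train Mgt0) (fourier_bell Mgt0)
  (measurable_comb_hat _ _ _ _ _) (measurable_comb_hat _ _ _ _ _)
  (comb_hat_bounded _ _ _ delta2_gt0 dl0) (comb_hat_bounded _ _ _ dl0 dl0)
  train_hat_ge0 (fun xi _ => bell_hat_ge0 M xi) hx).
have <- := @sum_gain (fun k => cap k `*` bell_core) _; last first.
  move=> k; transitivity (lebesgue_rV n.+1 (cap k) * lebesgue_rV n.+1 bell_core)%E.
    exact: product_measure1E.
  by rewrite lebesgue_cap lebesgue_core -EFinM.
apply: sum_measure_le_integral => //; first by move=> k; exact: measurableX.
move=> z; under eq_bigr do rewrite indic_setX.
exact: symbol_train_bell_ge.
Qed.

Lemma Re_bell_train_ge x : (forall i, `|x ord0 i| <= (32 * d)^-1) ->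
  gain / 2 <= complex.Re (bilinear_bochner_riesz alpha (bell M) (train M) x).
Proof.
move=> hx; apply: (Re_bilinear_bochner_riesz_ge alpha0 (fourier_bell Mgt0) (fourier_train Mgt0)
  (measurable_comb_hat _ _ _ _ _) (measurable_comb_hat _ _ _ _ _)
  (comb_hat_bounded _ _ _ dl0 dl0) (comb_hat_bounded _ _ _ delta2_gt0 dl0)
  (fun xi _ => bell_hat_ge0 M xi) train_hat_ge0 hx).
have <- := @sum_gain (fun k => bell_core `*` cap k) _; last first.
  move=> k; transitivity (lebesgue_rV n.+1 bell_core * lebesgue_rV n.+1 (cap k))%E.
    exact: product_measure1E.
  by rewrite lebesgue_cap lebesgue_core muleC -EFinM.
apply: sum_measure_le_integral => //; first by move=> k; exact: measurableX.
move=> z; under eq_bigr do rewrite indic_setX [X in level * X]mulrC.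
by rewrite bochner_riesz_symbolC mulrAC; exact: symbol_train_bell_ge.
Qed.

Definition gain_const : R :=
  d^-1 `^ alpha * (2^-1 * (expR (- (pi * (n + 3)%:R ^+ 2)) * expR (- (pi * n%:R))) *
   expR (- (pi * d)) * ((2 * box_const) ^+ n * (2 * box_const) ^+ n.+1)).

Lemma gain_const_gt0 : 0 < gain_const.
Proof.
rewrite !mulr_gt0 ?expR_gt0 ?powR_gt0 ?exprn_gt0 ?mulr_gt0 ?invr_gt0//.
Qed.

(** Amplitudes cancel against volumes: M^(n+2) against the cap, M^(n+1) against the core. The number
    of packets and the size of the symbol remain. *)
Lemma gainE : gain = gain_const * (M%:R ^+ n * dl `^ alpha).
Proof.
rewrite /gain /level /train_level /bell_level /gain_const.
rewrite powRM ?invr_ge0 ?(ltW dl0)//.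
have e (c : R) m : (2 * (c / M%:R)) ^+ m = (2 * c) ^+ m / M%:R ^+ m.
  by rewrite mulrA exprMn exprVn.
have key (m D A u v w B1 B2 : R) : 0 < m ->
    m ^+ n * (D * A * (2^-1 * m ^+ n.+2 * (u * v)) * (m ^+ n.+1 * w) *
      (m^-1 ^+ 2 * (B1 / m ^+ n) * (B2 / m ^+ n.+1))) =
    A * (2^-1 * (u * v) * w * (B1 * B2)) * (m ^+ n * D).
  move=> m0; rewrite (exprS m n.+1) (exprS m n).
  have : 0 < m ^+ n by exact: exprn_gt0.
  by generalize (m ^+ n) => Q Q0; field; rewrite !gt_eqF.
by rewrite !e; exact: key MR.
Qed.

End lower_bound.

(** * Conclusion *)

Section exponents.
Context {R : realType}.

Lemma powR_bounded_le0 (s K : R) (M0 : nat) :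
  (forall M : nat, (M0 <= M)%N -> (0 < M)%N -> M%:R `^ s <= K) -> s <= 0.
Proof.
move=> h; rewrite leNgt; apply/negP => s0.
(* Solves A^s = |K| + 1, so any M above A contradicts the bound. *)
pose A := (`|K| + 1) `^ s^-1.
have K1 : 0 < `|K| + 1 by rewrite ltr_wpDl.
pose M := (maxn M0 (Num.bound A).+1).
have hM : A < M%:R.
  have A0 : 0 <= A by exact: powR_ge0.
  apply: (lt_le_trans (archi_boundP A0)); rewrite ler_nat.
  exact: leq_trans (leqnSn _) (leq_maxr _ _).
have := h M (leq_maxl _ _) (leq_trans (ltn0Sn _) (leq_maxr _ _)).
have : A `^ s <= M%:R `^ s.
  by apply: ge0_ler_powR; rewrite ?nnegrE ?powR_ge0// ltW.
rewrite /A -powRrM mulVf ?gt_eqF// powRr1 ?(ltW K1)// => h1 h2.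
have := le_trans h1 h2; have := ler_norm K; lra.
Qed.

(** As powers of M the two sides have exponents n - 2 alpha and 2 (n + 1) P + (n + 1) Q; boundedness
    of the quotient for large M orders them. *)
Lemma exponent_le (n : nat) (alpha P Q c K : R) (M0 : nat) : 0 < c ->
  (forall M : nat, (M0 <= M)%N -> (0 < M)%N ->
     c * (M%:R ^+ n * delta M `^ alpha) <=
     K * ((delta M ^+ 2) `^ (- (n.+1%:R / 2 * P)) * delta M `^ (- (n.+1%:R / 2 * Q)))) ->
  n%:R / 2 - n.+1%:R * P - n.+1%:R / 2 * Q <= alpha.
Proof.
move=> c0 h.
suff : n%:R - 2 * alpha - 2 * n.+1%:R * P - n.+1%:R * Q <= 0 by lra.
apply: (@powR_bounded_le0 _ (c^-1 * K) M0) => M hM M1.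
have m0 : 0 < M%:R :> R by rewrite ltr0n.
have mn0 : (M%:R : R) != 0 by rewrite gt_eqF.
have dE (s : R) : delta M `^ s = M%:R `^ (- (2 * s)).
  have -> : delta M = M%:R `^ (- 2) :> R.
    by rewrite /delta exprVn powRN -powR_mulrn// ltW.
  by rewrite -powRrM mulNr.
have d2E (s : R) : (delta M ^+ 2) `^ s = M%:R `^ (- (4 * s)).
  rewrite -powR_mulrn ?(ltW (delta_gt0 M1))// -powRrM dE; congr (_ `^ _); ring.
have := h M hM M1; rewrite d2E !dE -(powR_mulrn n (ltW m0)).
rewrite -!powRD ?mn0 ?implybT// => h1.
have -> : n%:R - 2 * alpha - 2 * n.+1%:R * P - n.+1%:R * Q =
   (n%:R + - (2 * alpha)) - (- (4 * (- (n.+1%:R / 2 * P))) + - (2 * (- (n.+1%:R / 2 * Q)))).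
  by field.
rewrite powRB ?mn0 ?implybT// ler_pdivrMr ?powR_gt0// -[leRHS]mulrA ler_pdivlMl//.
Qed.

Lemma Re_le_normc (z : R[i]) : complex.Re z <= ComplexField.Normc.normc z.
Proof.
case: z => a b /=; rewrite (le_trans (ler_norm _))// -sqrtr_sqr ler_wsqrtr//.
by rewrite lerDl sqr_ge0.
Qed.

Lemma bounded_lower (n : nat) (p q r : \bar R)
    (T : ('rV[R]_n.+1 -> R[i]) -> ('rV[R]_n.+1 -> R[i]) -> 'rV[R]_n.+1 -> R[i]) :
  (1 <= r)%E -> bounded_on_schwartz T p q r ->
  exists c K : R, [/\ 0 < c, 0 <= K & forall f g (A Df Dg : R),
    schwartz f -> schwartz g -> 0 <= A -> 0 <= Df -> 0 <= Dg ->
    (Lpnorm p f <= Df%:E)%E -> (Lpnorm q g <= Dg%:E)%E ->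
    (forall x : 'rV[R]_n.+1, (forall i, `|x ord0 i| <= (32 * n.+1%:R)^-1) -> A <= complex.Re (T f g x)) ->
    c * A <= K * (Df * Dg)].
Proof.
move=> r1 [K hK].
have c0 : 0 < (32 * n.+1%:R)^-1 :> R by rewrite invr_gt0 mulr_gt0.
have [c [cpos hc]] := @Lpnorm_ge_cube R n.+1 r _ r1 c0.
(* K may be negative; its absolute value lets the norms be replaced by their upper bounds. *)
exists c, `|K|; split => // f g A Df Dg sf sg A0 Df0 Dg0 hf hg hA.
rewrite -lee_fin; apply: (@le_trans _ _ (Lpnorm r (T f g))).
  apply: hc => // x hx; apply: le_trans (Re_le_normc _); apply: hA => i.
  by rewrite ler_norml; have := hx i; rewrite in_itv.
apply: (le_trans (hK f g sf sg)); rewrite !EFinM muleA.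
have Lf0 : (0 <= Lpnorm p f)%E by exact: Lnorm_ge0.
have Lg0 : (0 <= Lpnorm q g)%E by exact: Lnorm_ge0.
apply: (@le_trans _ _ (`|K|%:E * Lpnorm p f * Lpnorm q g)%E).
  by apply: lee_wpmul2r => //; apply: lee_wpmul2r => //; rewrite lee_fin ler_norm.
apply: lee_pmul => //; first by rewrite mule_ge0// lee_fin.
by apply: lee_wpmul2l; rewrite ?lee_fin.
Qed.

Lemma necessary_exponents (n : nat) (alpha : R) (p q r : \bar R) :
  (0 < n)%N -> 0 <= alpha -> (1 <= p)%E -> (1 <= q)%E -> (1 <= r)%E ->
  bounded_on_schwartz (@bilinear_bochner_riesz R n.+1 alpha) p q r ->
  n%:R / 2 - n.+1%:R * fine p^-1 - n.+1%:R / 2 * fine q^-1 <= alpha /\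
  n%:R / 2 - n.+1%:R * fine q^-1 - n.+1%:R / 2 * fine p^-1 <= alpha.
Proof.
move=> n0 a0 p1 q1 r1 /(bounded_lower r1)[c [K [cpos K0 hcK]]].
have CT : 0 <= (2 * pi) ^+ n * (3 * pi) ^+ n :> R.
  by rewrite mulr_ge0 ?exprn_ge0 ?mulr_ge0 ?pi_ge0.
have kT : 0 < (4 * n%:R)^-1 :> R by rewrite invr_gt0 mulr_gt0 ?ltr0n.
have train_le s : (1 <= s)%E -> exists D, 0 <= D /\ forall M, (0 < M)%N ->
    (Lpnorm s (@train R n M) <= (D * (delta M ^+ 2) `^ (- (n.+1%:R / 2 * fine s^-1)))%:E)%E.
  move=> s1; have [D [D0 hD]] := Lpnorm_gauss_le n.+1 s1 CT kT.
  exists D; split => // M M1; apply: hD; first by rewrite exprn_gt0// delta_gt0.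
  by move=> x; exact: normc_train.
have bell_le s : (1 <= s)%E -> exists D, 0 <= D /\ forall M, (0 < M)%N ->
    (Lpnorm s (@bell R n M) <= (D * delta M `^ (- (n.+1%:R / 2 * fine s^-1)))%:E)%E.
  move=> s1; have [D [D0 hD]] := Lpnorm_gauss_le n.+1 s1 (@ler01 R) (@ltr01 R).
  exists D; split => // M M1; apply: hD; first exact: delta_gt0.
  by move=> x; exact: normc_bell.
have g0 : 0 < c * (gain_const n alpha / 2) by rewrite mulr_gt0// divr_gt0// gain_const_gt0.
have gain0 M : 0 <= gain_const n alpha / 2 * (M%:R ^+ n * delta M `^ alpha).
  apply: mulr_ge0; first by rewrite divr_ge0// ltW// gain_const_gt0.
  by rewrite mulr_ge0 ?exprn_ge0 ?powR_ge0.
split.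
- have [D [D0 hD]] := train_le p p1; have [E [E0 hE]] := bell_le q q1.
  apply: (@exponent_le n alpha _ _ _ (K * (D * E)) (4 * n.+1 ^ 2) g0) => M hM M1.
  have := hcK (train M) (bell M) _ _ _ (schwartz_train n M1) (schwartz_bell n M1)
    (gain0 M) (mulr_ge0 D0 (powR_ge0 _ _)) (mulr_ge0 E0 (powR_ge0 _ _)) (hD M M1) (hE M M1).
  rewrite [X in _ -> _ <= X]mulrA [X in _ -> _ <= X](_ : _ = K * (D * (delta M ^+ 2) `^ (- (n.+1%:R / 2 * fine p^-1)) *
    (E * delta M `^ (- (n.+1%:R / 2 * fine q^-1))))); last by ring.
  rewrite -[X in _ -> X <= _]mulrA; apply => x hx.
  have := Re_train_bell_ge hM a0 hx; rewrite gainE// mulrAC.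
  by [].
- have [D [D0 hD]] := train_le q q1; have [E [E0 hE]] := bell_le p p1.
  apply: (@exponent_le n alpha _ _ _ (K * (E * D)) (4 * n.+1 ^ 2) g0) => M hM M1.
  have := hcK (bell M) (train M) _ _ _ (schwartz_bell n M1) (schwartz_train n M1)
    (gain0 M) (mulr_ge0 E0 (powR_ge0 _ _)) (mulr_ge0 D0 (powR_ge0 _ _)) (hE M M1) (hD M M1).
  rewrite [X in _ -> _ <= X]mulrA [X in _ -> _ <= X](_ : _ = K * (E * delta M `^ (- (n.+1%:R / 2 * fine p^-1)) *
    (D * (delta M ^+ 2) `^ (- (n.+1%:R / 2 * fine q^-1))))); last by ring.
  rewrite -[X in _ -> X <= _]mulrA; apply => x hx.
  have := Re_bell_train_ge hM a0 hx; rewrite gainE// mulrAC.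
  by [].
Qed.

(** At p = +oo both sides are 0, which is the convention d / p = 0. *)
Lemma dive_fine (a : R) (p : \bar R) : (1 <= p)%E -> (a%:E / p = (a * fine p^-1)%:E)%E.
Proof.
case: p => [s|_|//]; last by rewrite invey mule0 mulr0.
rewrite lee_fin => s1; have s0 : s != 0 by rewrite gt_eqF// (lt_le_trans _ s1).
by rewrite inver (negbTE s0).
Qed.

Lemma dive2_fine (a : R) (p : \bar R) : (1 <= p)%E ->
  (a%:E / (2%:E * p) = (a / 2 * fine p^-1)%:E)%E.
Proof.
case: p => [s|_|//]; last by rewrite gt0_muley ?lte_fin// invey mule0 mulr0.
rewrite lee_fin => s1; have s0 : s != 0 by rewrite gt_eqF// (lt_le_trans _ s1).
by rewrite -EFinM !inver mulf_eq0 (negbTE s0) pnatr_eq0/= -EFinM invfM mulrA.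
Qed.

End exponents.

Theorem proposition4p6 (R : realType) (d : nat) (alpha : R) (p q r : \bar R)
    (hd : (2 <= d)%N) (halpha : 0 <= alpha)
    (hp : (1 <= p)%E) (hq : (1 <= q)%E) (hr : (1 <= r)%E)
    (hB : bounded_on_schwartz (@bilinear_bochner_riesz R d alpha) p q r) :
  (maxe (((d%:R - 1) / 2)%R%:E - d%:R%:E / p - d%:R%:E / (2%:E * q))
     (maxe (((d%:R - 1) / 2)%R%:E - d%:R%:E / q - d%:R%:E / (2%:E * p)) 0)
   <= alpha%:E)%E.
Proof.
case: d hd hB => [//|n] hn hB.
(* With d = n + 1, the assumption 2 <= d is convertible to 0 < n. *)
have [h1 h2] := necessary_exponents hn halpha hp hq hr hB.
rewrite !dive2_fine// !dive_fine// !ge_max -!EFinB !lee_fin halpha andbT.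
by rewrite -natr1 addrK natr1 h1 h2.
Qed.
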